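(* Let $F$ be a field, let $\mathbb{H}_F$ be a quaternion algebra over $F$, let $m>1$ be an integer, and let $p\in F\langle x_1,\ldots,x_m\rangle$ be a multilinear polynomial. Let $s_2=x_1x_2-x_2x_1$. (i) If $\mathbb{H}_F$ is not a division ring, then $p(\mathbb{H}_F)=\{0\}$, or $p(\mathbb{H}_F)=F$, or $p(\mathbb{H}_F)\supseteq s_2(\mathbb{H}_F)$. In particular, if (in addition) $F$ is a quadratically closed field, then $p(\mathbb{H}_F)\in\{\{0\},F,s_2(\mathbb{H}_F),\mathbb{H}_F\}$. (ii) If $F$ is the field of real numbers, then $p(\mathbb{H}_F)\in\{\{0\},F,s_2(\mathbb{H}_F),\mathbb{H}_F\}$.
   Context: A quaternion algebra $\mathbb{H}_F$ over a field $F$ is an associative unital $F$-algebra which is a $4$-dimensional $F$-vector space with basis $1,i,j,k$ such that: if $\mathrm{char}\,F\neq 2$, then $i^2,j^2\in F$ are nonzero and $k=ij=-ji$; if $\mathrm{char}\,F=2$, then $j^2\in F$ is nonzero, $i^2+i\in F$, and $k=ij=j(i+1)$. $F$ is identified with $F\cdot 1\subseteq\mathbb{H}_F$. $F\langle x_1,\ldots,x_m\rangle$ is the free associative algebra; a polynomial is multilinear (of degree $m$) if it has the form $p=\sum_{\sigma\in S_m}\lambda_\sigma x_{\sigma(1)}\cdots x_{\sigma(m)}$ with $\lambda_\sigma\in F$. For an $F$-algebra $A$, $p(A)=\{p(a_1,\ldots,a_m)\mid a_1,\ldots,a_m\in A\}$; in particular $s_2(A)=\{ab-ba\mid a,b\in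 A\}$. A field is quadratically closed if every element has a square root in it. *)

(* Defs.v *)
From HB Require Import structures.
From mathcomp Require Import all_boot all_algebra perm falgebra.
From mathcomp Require Import classical_sets reals.
From mathcomp Require Import monalg.

Set Implicit Arguments.
Unset Strict Implicit.
Unset Printing Implicit Defensive.

Import GRing.Theory.
Local Open Scope ring_scope.
Local Open Scope classical_set_scope.

Definition quaternion_relations (F : fieldType) (A : falgType F) (i j : A)
    : Prop :=
  if 2%N \in [pchar F] then
    [/\ exists2 b : F, b != 0 & j ^+ 2 = b%:A,
        exists a : F, i ^+ 2 + i = a%:A
      & i * j = j * (i + 1)]
  else
    [/\ exists2 a : F, a != 0 & i ^+ 2 = a%:A,
        exists2 b : F, b != 0 & j ^+ 2 = b%:A
      & i * j = - (j * i)].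

Definition is_quaternion_algebra (F : fieldType) (A : falgType F) : Prop :=
  exists i j : A,
    basis_of {:A} [:: 1; i; j; i * j] /\ quaternion_relations i j.

Definition is_division_ring (A : unitRingType) : Prop :=
  forall x : A, x != 0 -> x \is a GRing.unit.

Definition quadratically_closed (F : fieldType) : Prop :=
  forall a : F, exists b : F, b ^+ 2 = a.

(* The free associative algebra F<x_0, ..., x_(m-1)>: the monoid algebra over F
   of the free monoid of words in 'I_m; the variables are indexed from 0. *)
Notation free_algebra F m := {malg F[{fmonom 'I_m}]}.

Definition free_var (F : fieldType) (m : nat) (i : 'I_m) : free_algebra F m :=
  << fmu i >>.

Definition multilinear (F : fieldType) (m : nat) (p : free_algebra F m) : Prop :=
  exists lam : 'S_m -> F,
    p = \sum_(s : 'S_m) lam s *: \prod_(k < m) free_var F (s k).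

Definition free_eval (F : fieldType) (m : nat) (A : falgType F)
    (a : 'I_m -> A) (p : free_algebra F m) : A :=
  mmap (in_alg A) (fun w : {fmonom 'I_m} => \prod_(i <- (w : seq 'I_m)) a i) p.

Definition poly_image (F : fieldType) (m : nat) (p : free_algebra F m)
    (A : falgType F) : set A :=
  [set free_eval a p | a in [set: 'I_m -> A]].
Arguments poly_image {F m} p A _.

Definition s2 (F : fieldType) : free_algebra F 2 :=
  free_var F ord0 * free_var F ord_max - free_var F ord_max * free_var F ord0.

Definition scalars (F : fieldType) (A : falgType F) : set A :=
  [set c%:A | c in [set: F]].
Arguments scalars {F} A _.

(* Main.v *)
(* Write f for the evaluation of p, a multilinear function equivariant under
   conjugation, and I for its image.  If adjacent nonzero values of f (arguments
   differing in one coordinate) are always equivalent for some equivalence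
   relation, then all its nonzero values are equivalent; for collinearity this
   yields: if f has two non-collinear values, some pencil
   s |-> f(.., s x + t y, ..) has a 2-dimensional image.

   A quaternion algebra that is not a division ring is M_2(F).  There f maps
   matrix units to weight vectors.  If f is not central, some tuple of matrix
   units is sent to a nonzero multiple of e12 or e21; swapping the indices gives
   a non-collinear value of the same parity, so I contains all off-diagonal
   matrices, hence up to conjugation all non-scalar traceless ones.  If moreover
   some value has nonzero trace, and char F is not 2, perturbing this pencil of
   off-diagonal matrices gives a plane in I on which the trace is nonzero and the
   discriminant form is nondegenerate: it contains every ratio det / tr^2.  In
   characteristic 2 one applies partial conjugations by unipotents to a
   tuple from {1, e11, e12, e21} with a value of nonzero trace, chosen so that
   commutators with e12 and e21 in two coordinates make the trace vanish, and
   solves a quadratic equation for the determinant.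

   For the Hamilton quaternions the basis 1, i, j, k replaces the matrix units,
   and the relation "re(x)^2 - k |x|^2 has the same sign" replaces collinearity. *)
Require Import Defs.
From HB Require Import structures.
From mathcomp Require Import all_boot all_order all_algebra perm falgebra.
From mathcomp Require Import classical_sets reals boolp.
From mathcomp Require Import monalg ring lra.

Set Implicit Arguments.
Unset Strict Implicit.
Unset Printing Implicit Defensive.

Import Order.TTheory GRing.Theory Num.Theory.
Local Open Scope ring_scope.

(** * Tuples with one coordinate changed *)

Definition upd (T : Type) (m : nat) (u : 'I_m -> T) (l : 'I_m) (x : T) :
  'I_m -> T := fun j => if j == l then x else u j.

Lemma upd_same T m (u : 'I_m -> T) l x : upd u l x l = x.
Proof. by rewrite /upd eqxx. Qed.

Lemma upd_other T m (u : 'I_m -> T) l x j : j != l -> upd u l x j = u j.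
Proof. by rewrite /upd => /negbTE ->. Qed.

Lemma upd_id T m (u : 'I_m -> T) l : upd u l (u l) = u.
Proof. by apply/funext => j; rewrite /upd; case: eqP => // ->. Qed.

Lemma upd_upd T m (u : 'I_m -> T) l x y : upd (upd u l x) l y = upd u l y.
Proof. by apply/funext => j; rewrite /upd; case: eqP. Qed.

Lemma updC T m (u : 'I_m -> T) l k x y : l != k ->
  upd (upd u l x) k y = upd (upd u k y) l x.
Proof.
move=> lk; apply/funext => j; rewrite /upd.
by case: (eqVneq j k) => // ->; rewrite eq_sym (negbTE lk).
Qed.

Lemma upd_pred T m (V : 'I_m -> T -> Prop) (u : 'I_m -> T) l x :
  (forall j, V j (u j)) -> V l x -> forall j, V j (upd u l x j).
Proof. by move=> Vu Vx j; rewrite /upd; case: eqP => // ->. Qed.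

(** * Multilinear functions *)

Section Multilinear.
Variables (F : fieldType) (A : lalgType F) (m : nat).

Definition multilin (f : ('I_m -> A) -> A) : Prop :=
  forall u l (c : F) x y,
    f (upd u l (c *: x + y)) = c *: f (upd u l x) + f (upd u l y).

Definition lin_closed (P : A -> Prop) : Prop :=
  forall (c : F) x y, P x -> P y -> P (c *: x + y).

(** Linear span in the form of an induction principle. Since [lin_closed] does not mention 0, a
    combination of elements of [B] has to end in an element of [B]. *)
Definition spanning (B : A -> Prop) : Prop :=
  forall S : A -> Prop, (forall x, B x -> S x) -> lin_closed S ->
  forall x, S x.

Variable f : ('I_m -> A) -> A.
Hypothesis fL : multilin f.

Lemma multilinD u l x y :
  f (upd u l (x + y)) = f (upd u l x) + f (upd u l y).
Proof. by rewrite -[x in LHS]scale1r fL scale1r. Qed.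

Lemma multilin0 u l : f (upd u l 0) = 0.
Proof.
have := multilinD u l 0 0; rewrite addr0 => /eqP.
by rewrite -subr_eq0 opprD addNKr oppr_eq0 => /eqP.
Qed.

Lemma multilinZ u l c x : f (upd u l (c *: x)) = c *: f (upd u l x).
Proof. by rewrite -[c *: x]addr0 fL multilin0 addr0. Qed.

(** The arguments are freed one at a time: at stage [k] only those of index at least [k] are still
    required to lie in [B]. *)
Lemma multilin_ind (B P : A -> Prop) :
  spanning B -> lin_closed P ->
  (forall u, (forall j, B (u j)) -> P (f u)) -> forall u, P (f u).
Proof.
move=> spanB linP PB.
suff step k u : (forall j : 'I_m, (k <= j)%N -> B (u j)) -> P (f u).
  by move=> u; apply: (step m) => j; rewrite leqNgt ltn_ord.
elim: k u => [|k IHk] u Bu; first by apply: PB => j; apply: Bu.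
have [ltkm|lemk] := ltnP k m; last first.
  by apply: IHk => j lekj; have := ltn_ord j; rewrite ltnNge (leq_trans lemk).
pose l := Ordinal ltkm; rewrite -(upd_id u l).
apply: (spanB (fun x => P (f (upd u l x)))) => [x Bx|c x y Px Py].
  apply: IHk => j lekj; rewrite /upd; case: eqVneq => // jl; apply: Bu.
  by rewrite ltn_neqAle lekj andbT; apply: contraNN jl => /eqP kj; apply/eqP/val_inj.
by rewrite fL; apply: linP.
Qed.

(* If changing one differing coordinate of u into that of v, or vice versa,
   gives a nonzero value, induct on the number of differing coordinates.
   Otherwise putting u_l + v_l in the coordinate l of both points changes
   neither value, and makes the points agree in l. *)
Lemma multilin_connect (V : 'I_m -> A -> Prop) (R : A -> A -> Prop) :
  (forall j x y, V j x -> V j y -> V j (x + y)) ->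
  (forall x, R x x) -> (forall x y z, R x y -> R y z -> R x z) ->
  (forall u l y, (forall j, V j (u j)) -> V l y ->
     f u != 0 -> f (upd u l y) != 0 -> R (f u) (f (upd u l y))) ->
  forall u v, (forall j, V j (u j)) -> (forall j, V j (v j)) ->
    f u != 0 -> f v != 0 -> R (f u) (f v).
Proof.
move=> VD Rxx Rtr Radj u v.
have [n] := ubnP #|[set j | u j != v j]|.
elim: n u v => // n IHn u v; rewrite ltnS => card_uv Vu Vv fu fv.
have [uv|[l]] := set_0Vmem [set j | u j != v j].
  suff -> : u = v by [].
  apply/funext => j; apply/eqP; move/setP: uv => /(_ j).
  by rewrite !inE => /negbFE.
rewrite inE => uvl.
have agree (u' v' : 'I_m -> A) : u' l = v' l ->
    (forall j, j != l -> u' j = u j) -> (forall j, j != l -> v' j = v j) ->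
    (#|[set j | u' j != v' j]| < n)%N.
  move=> eql eu ev; apply: leq_trans card_uv; apply: proper_card.
  apply/properP; split.
    apply/fintype.subsetP => j; rewrite !inE; case: (eqVneq j l) => [->|jl].
      by rewrite eql eqxx.
    by rewrite eu // ev.
  by exists l; rewrite inE // eql eqxx.
have [ful0|ful] := eqVneq (f (upd u l (v l))) 0; last first.
  apply: Rtr (Radj _ _ _ Vu (Vv l) fu ful) _.
  apply: IHn => //; last exact: upd_pred.
  by apply: agree => // [|j jl]; rewrite ?upd_same ?upd_other.
have [fvl0|fvl] := eqVneq (f (upd v l (u l))) 0; last first.
  apply: (Rtr _ (f (upd v l (u l)))).
    apply: IHn => //; last exact: upd_pred.
    by apply: agree => // [|j jl]; rewrite ?upd_same ?upd_other.
  have := @Radj (upd v l (u l)) l (v l); rewrite upd_upd upd_id.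
  by apply=> //; apply: upd_pred.
have eu : f (upd u l (u l + v l)) = f u by rewrite multilinD upd_id ful0 addr0.
have ev : f (upd v l (u l + v l)) = f v by rewrite multilinD upd_id fvl0 add0r.
rewrite -eu -ev; apply: IHn; rewrite ?eu ?ev //; last 2 first.
- by apply: upd_pred => //; apply: VD.
- by apply: upd_pred => //; apply: VD.
by apply: agree => [|j jl|j jl]; rewrite ?upd_same ?upd_other.
Qed.

(** The contrapositive of [multilin_connect] for collinearity. The predicates [V] keep every tuple
    inside prescribed subspaces, in practice homogeneous components. *)
Lemma multilin_pencil (V : 'I_m -> A -> Prop) u v :
  (forall j x y, V j x -> V j y -> V j (x + y)) ->
  (forall j, V j (u j)) -> (forall j, V j (v j)) ->
  f u != 0 -> f v != 0 -> (forall k : F, f v <> k *: f u) ->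
  exists u' l y, [/\ forall j, V j (u' j), V l y, f u' != 0
    & forall k : F, f (upd u' l y) <> k *: f u'].
Proof.
move=> VD Vu Vv fu fv ncol; apply: contrapT => no.
suff [k fvE] : exists k : F, f v = k *: f u by apply: (ncol k).
apply: (@multilin_connect V (fun x y => exists k : F, y = k *: x)) => //.
- by move=> x; exists 1; rewrite scale1r.
- by move=> x y z [k ->] [k' ->]; exists (k' * k); rewrite scalerA.
- move=> u' l y Vu' Vy fu' fu'y; apply: contrapT => no'.
  by apply: no; exists u', l, y; split => // k fE; apply: no'; exists k.
Qed.

(** Induction on the number [k] of coordinates that move along the line, following the coefficient
    of degree [k]. The top coefficient later shows that a polynomial is nonzero. *)
Lemma multilin_line (phi : A -> F) :
  (forall c x y, phi (c *: x + y) = c * phi x + phi y) ->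
  forall u v, exists p : {poly F}, p`_m = phi (f v) /\
    forall t, p.[t] = phi (f (fun j => u j + t *: v j)).
Proof.
move=> phiL u v.
(* Coordinates below [k] come from [w], the others from [r]. *)
pose mix k (w r : 'I_m -> A) : 'I_m -> A := fun j => if (j < k)%N then w j else r j.
suff step k r : (k <= m)%N -> exists p : {poly F},
    [/\ (size p <= k.+1)%N, p`_k = phi (f (mix k v r)) &
        forall t, p.[t] = phi (f (mix k (fun j => u j + t *: v j) r))].
  have [p [_ pm pE]] := step m v (leqnn m).
  have mixm w : mix m w v = w by apply/funext => j; rewrite /mix ltn_ord.
  by exists p; split=> [|t]; rewrite ?pm ?pE mixm.
elim: k r => [|k IHk] r lekm.
  exists (phi (f r))%:P; split; rewrite ?size_polyC ?leq_b1 ?coefC //.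
  by move=> t; rewrite hornerC.
pose l := Ordinal lekm.
have mixS w : mix k.+1 w r = mix k w (upd r l (w l)).
  apply/funext => j; rewrite /mix /upd ltnS leq_eqVlt -val_eqE /=.
  by case: (ltngtP j k) => //= jk; congr (w _); apply/val_inj.
have mixU w y : mix k w (upd r l y) = upd (mix k w r) l y.
  by apply/funext => j; rewrite /mix /upd -val_eqE /=; case: ltngtP.
have [p [sp pk pE]] := IHk (upd r l (u l)) (ltnW lekm).
have [q [sq qk qE]] := IHk (upd r l (v l)) (ltnW lekm).
exists (p + 'X * q); split.
- apply: leq_trans (size_polyD _ _) _; rewrite geq_max (leq_trans sp) //=.
  by apply: leq_trans (size_polyMleq _ _) _; rewrite size_polyX; exact: sq.
- by rewrite poly.coefD coefXM /= [p`__]nth_default ?add0r ?qk ?mixS.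
- move=> t; rewrite !hornerE pE qE mixS !mixU multilinD multilinZ.
  by rewrite addrC -phiL addrC.
Qed.

End Multilinear.

(** * Evaluation of multilinear polynomials *)

Section MultilinearEvaluation.
Variables (F : fieldType) (A : falgType F) (m : nat) (lam : 'S_m -> F).

Definition mleval (u : 'I_m -> A) : A :=
  \sum_(s : 'S_m) lam s *: \prod_(k < m) u (s k).

Lemma free_eval_mleval (p : free_algebra F m) :
  p = \sum_(s : 'S_m) lam s *: \prod_(k < m) free_var F (s k) ->
  forall u, free_eval u p = mleval u.
Proof.
move=> -> u; rewrite /free_eval raddf_sum; apply: eq_bigr => s _.
have [w [-> wE]] : exists w : {fmonom 'I_m},
    \prod_(k < m) free_var F (s k) = << w >> /\
    (w : seq 'I_m) = [seq s k | k <- index_enum 'I_m].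
  elim: (index_enum 'I_m) => [|k r [w [prodE wE]]].
    by exists (@mone {fmonom _}); rewrite big_nil fm1.
  exists (mmul (fmu (s k)) w); rewrite big_cons prodE fmM fmU wE; split=> //.
  by rewrite malgM_def fgmulUU mulr1.
rewrite -mul_malgC malgM_def fgmulUU mul1m mulr1 /= mmapU /= mulr_algl wE.
by rewrite big_map.
Qed.

Lemma prod_lin (I : eqType) (r : seq I) (k0 : I) (c : F) (g g1 g2 : I -> A) :
  uniq r -> k0 \in r -> g k0 = c *: g1 k0 + g2 k0 ->
  (forall k, k != k0 -> g1 k = g k) -> (forall k, k != k0 -> g2 k = g k) ->
  \prod_(k <- r) g k = c *: \prod_(k <- r) g1 k + \prod_(k <- r) g2 k.
Proof.
move=> + + gE g1E g2E; elim: r => // k r IHr /= /andP[knr ur].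
rewrite inE !big_cons; case: (eqVneq k0 k) => [k0k _|kk0 /= k0r].
  have same g' : (forall k, k != k0 -> g' k = g k) ->
      \prod_(j <- r) g' j = \prod_(j <- r) g j.
    move=> g'E; apply: eq_big_seq => j jr; apply: g'E.
    by apply: contraNneq knr => jk0; rewrite -k0k -jk0.
  by rewrite !same // -k0k gE mulrDl scalerAl.
by rewrite (IHr ur k0r) g1E 1?eq_sym // g2E 1?eq_sym // mulrDr scalerAr.
Qed.

Lemma mleval_multilin : multilin mleval.
Proof.
move=> u l c x y; rewrite /mleval scaler_sumr -big_split /=.
apply: eq_bigr => s _; rewrite scalerA mulrC -scalerA -scalerDr; congr (_ *: _).
apply: (@prod_lin _ _ (s^-1 l)%g); rewrite ?index_enum_uniq ?mem_index_enum //.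
- by rewrite permKV !upd_same.
- by move=> k; rewrite -(inj_eq (@perm_inj _ s)) permKV => kl; rewrite !upd_other.
- by move=> k; rewrite -(inj_eq (@perm_inj _ s)) permKV => kl; rewrite !upd_other.
Qed.

Lemma mleval_conj (z z' : A) u : z * z' = 1 -> z' * z = 1 ->
  mleval (fun j => z * u j * z') = z * mleval u * z'.
Proof.
move=> zz' z'z; rewrite /mleval mulr_sumr mulr_suml; apply: eq_bigr => s _.
rewrite -scalerAr -scalerAl; congr (_ *: _).
elim: (index_enum _) => [|k r IHr]; first by rewrite !big_nil mulr1.
by rewrite !big_cons IHr !mulrA -(mulrA _ z' z) z'z mulr1.
Qed.

(** All monomials of a multilinear polynomial are permutations of one product, so for a commutative
    grading monoid they have the same degree. *)
Lemma mleval_graded (T : Type) (idx : T) (op : Monoid.com_law idx)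
    (hom : T -> A -> Prop) :
  (forall g, hom g 0) -> (forall g, lin_closed (hom g)) -> hom idx 1 ->
  (forall g h x y, hom g x -> hom h y -> hom (op g h) (x * y)) ->
  forall d u, (forall j, hom (d j) (u j)) ->
    hom (\big[op/idx]_j d j) (mleval u).
Proof.
move=> hom0 homL hom1 homM d u du; apply: big_ind => [//|x y hx hy|s _].
  by rewrite -[x]scale1r; apply: homL.
rewrite -[_ *: _]addr0; apply: homL => //.
rewrite (reindex_inj (@perm_inj _ s)) /=.
by apply: (big_ind2 hom) => // g x h y; apply: homM.
Qed.

(** The commutator with [e] is a derivation, and each monomial contains every variable exactly
    once. *)
Lemma mleval_leibniz (e : A) u :
  \sum_i mleval (upd u i (e * u i - u i * e)) = e * mleval u - mleval u * e.
Proof.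
rewrite /mleval exchange_big mulr_sumr mulr_suml -sumrB /=.
apply: eq_bigr => s _; rewrite -scalerAr -scalerAl -scalerBr -scaler_sumr.
congr (_ *: _); rewrite (reindex_inj (@perm_inj _ s)) /=.
(* The sum is indexed by positions in the monomial instead of variables, which allows induction
   along the product. *)
have -> : \sum_j \prod_(k < m) upd u (s j) (e * u (s j) - u (s j) * e) (s k) =
    \sum_(j < m) \prod_(k < m)
      (if k == j then e * u (s k) - u (s k) * e else u (s k)).
  apply: eq_bigr => j _; apply: eq_bigr => k _.
  by rewrite /upd (inj_eq (@perm_inj _ s)); case: eqP => // ->.
have := index_enum_uniq 'I_m; elim: (index_enum 'I_m) => [_|k r IHr].
  by rewrite !big_nil mulr1 mul1r subrr.
move=> /= /andP[knr ur]; rewrite !big_cons eqxx.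
have -> : \prod_(j <- r)
    (if j == k then e * u (s j) - u (s j) * e else u (s j)) =
    \prod_(j <- r) u (s j).
  by apply: eq_big_seq => j jr; case: eqP jr knr => // -> ->.
have -> : \sum_(j <- r) \prod_(i <- k :: r)
      (if i == j then e * u (s i) - u (s i) * e else u (s i)) =
    u (s k) * \sum_(j <- r) \prod_(i <- r)
      (if i == j then e * u (s i) - u (s i) * e else u (s i)).
  rewrite mulr_sumr; apply: eq_big_seq => j jr; rewrite big_cons.
  by case: eqP jr knr => // -> ->.
by rewrite IHr // mulrBl mulrBr !mulrA addrA subrK.
Qed.

End MultilinearEvaluation.

(** * Matrix coordinates *)

(** An isomorphism with the 2 by 2 matrices, given by entries: [mx a b c d] has rows [a, b] and
    [c, d]. *)
Record matrix_coords (F : fieldType) (H : falgType F) := MatrixCoords {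
  mx :> F -> F -> F -> F -> H;
  c11 : H -> F; c12 : H -> F; c21 : H -> F; c22 : H -> F;
  mx_coords : forall x, mx (c11 x) (c12 x) (c21 x) (c22 x) = x;
  c11_mx : forall a b c d, c11 (mx a b c d) = a;
  c12_mx : forall a b c d, c12 (mx a b c d) = b;
  c21_mx : forall a b c d, c21 (mx a b c d) = c;
  c22_mx : forall a b c d, c22 (mx a b c d) = d;
  mx_linear : forall k a b c d a' b' c' d',
    k *: mx a b c d + mx a' b' c' d' =
    mx (k * a + a') (k * b + b') (k * c + c') (k * d + d');
  mx_mul : forall a b c d a' b' c' d',
    mx a b c d * mx a' b' c' d' =
    mx (a * a' + b * c') (a * b' + b * d') (c * a' + d * c') (c * b' + d * d');
  mx_one : mx 1 0 0 1 = 1 }.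

Definition conj_closed (A : nzRingType) (I : A -> Prop) : Prop :=
  forall z z' x, z * z' = 1 -> z' * z = 1 -> I x -> I (z * x * z').

Section MatrixCoordinates.
Variables (F : fieldType) (H : falgType F) (E : matrix_coords H).

Lemma mxP x : exists a b c d, x = E a b c d.
Proof. by exists (c11 E x), (c12 E x), (c21 E x), (c22 E x); rewrite mx_coords. Qed.

Definition cE := (c11_mx E, c12_mx E, c21_mx E, c22_mx E).

Lemma mx0 : E 0 0 0 0 = 0.
Proof.
by have := mx_linear E (-1) 1 1 1 1 1 1 1 1; rewrite scaleN1r mulr1 !addNr.
Qed.

Lemma mxD a b c d a' b' c' d' :
  E a b c d + E a' b' c' d' = E (a + a') (b + b') (c + c') (d + d').
Proof. by rewrite -[E a b c d]scale1r mx_linear !mul1r. Qed.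

Lemma mxZ k a b c d : k *: E a b c d = E (k * a) (k * b) (k * c) (k * d).
Proof. by rewrite -[_ *: _]addr0 -mx0 mx_linear !addr0. Qed.

Lemma mxB a b c d a' b' c' d' :
  E a b c d - E a' b' c' d' = E (a - a') (b - b') (c - c') (d - d').
Proof. by rewrite -scaleN1r mxZ !mulN1r mxD. Qed.

Lemma mx_scalar k : k%:A = E k 0 0 k.
Proof. by rewrite -(mx_one E) mxZ mulr1 mulr0. Qed.

Lemma mx_inj a b c d a' b' c' d' :
  E a b c d = E a' b' c' d' -> [/\ a = a', b = b', c = c' & d = d'].
Proof.
by move=> e; split; [have := congr1 (c11 E) e | have := congr1 (c12 E) e
  | have := congr1 (c21 E) e | have := congr1 (c22 E) e]; rewrite !cE.
Qed.

Definition mxtr x := c11 E x + c22 E x.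
Definition mxdet x := c11 E x * c22 E x - c12 E x * c21 E x.
Definition nonscalar x :=
  [|| c12 E x != 0, c21 E x != 0 | c11 E x != c22 E x].

Lemma mxtr_linear k x y : mxtr (k *: x + y) = k * mxtr x + mxtr y.
Proof.
have [a [b [c [d ->]]]] := mxP x; have [a' [b' [c' [d' ->]]]] := mxP y.
by rewrite mx_linear /mxtr !cE; ring.
Qed.

Lemma mxtr_commutator x y : mxtr (x * y - y * x) = 0.
Proof.
have [a [b [c [d ->]]]] := mxP x; have [a' [b' [c' [d' ->]]]] := mxP y.
by rewrite !mx_mul mxB /mxtr !cE; ring.
Qed.

Lemma mx_inverse a b c d : a * d - b * c != 0 ->
  exists z', E a b c d * z' = 1 /\ z' * E a b c d = 1.
Proof.
move=> D0; exists ((a * d - b * c)^-1 *: E d (- b) (- c) a).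
by rewrite -scalerAr -scalerAl !mx_mul !mxZ -(mx_one E);
   split; congr (mx E); field.
Qed.

(** A nonscalar matrix has a cyclic vector [v]; the columns of [z] are [v] and [x v], and
    Cayley-Hamilton gives the companion matrix. Here [v] is e1 if [c != 0], e2 if [b != 0], and e1 +
    e2 for a diagonal matrix. *)
Lemma companion_form x : nonscalar x -> exists z z',
  [/\ z * z' = 1, z' * z = 1 & x = z * E 0 (- mxdet x) 1 (mxtr x) * z'].
Proof.
move=> nsx.
suff [a [b [c [d [D0 xz]]]]] : exists a b c d, a * d - b * c != 0 /\
    x * E a b c d = E a b c d * E 0 (- mxdet x) 1 (mxtr x).
  have [z' [zz' z'z]] := mx_inverse D0.
  by exists (E a b c d), z'; rewrite -xz -mulrA zz' mulr1.
move: nsx; rewrite /nonscalar /mxtr /mxdet.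
have [a [b [c [d ->]]]] := mxP x; rewrite !cE.
have [c0|c0 _] := eqVneq c 0; last first.
  exists 1, a, 0, c; split; first by rewrite mul1r mulr0 subr0.
  by rewrite !mx_mul; congr (mx E); ring.
have [b0 /= da|b0 _] := eqVneq b 0; last first.
  exists 0, b, 1, d; split; first by rewrite mul0r mulr1 sub0r oppr_eq0.
  by rewrite !mx_mul; congr (mx E); ring.
exists 1, a, 1, d; split; first by rewrite mul1r mulr1 subr_eq0 eq_sym.
by rewrite !mx_mul c0 b0; congr (mx E); ring.
Qed.

Lemma conj_closed_tr_det (I : H -> Prop) x y : conj_closed I ->
  nonscalar x -> nonscalar y -> mxtr x = mxtr y -> mxdet x = mxdet y ->
  I x -> I y.
Proof.
move=> Ic nx ny etr edet Ix.
have [z [z' [zz' z'z xE]]] := companion_form nx.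
have [w [w' [ww' w'w yE]]] := companion_form ny.
rewrite yE -edet -etr; apply: (Ic) => //; set C := E _ _ _ _ in xE *.
suff -> : C = z' * x * z by apply: Ic.
by rewrite xE !mulrA z'z mul1r -mulrA z'z mulr1.
Qed.

(** A traceless nonscalar matrix is conjugate to its companion matrix, which is off-diagonal.
    Nonzero traceless scalars exist only in characteristic 2 and need the second hypothesis. *)
Lemma traceless_sub (I : H -> Prop) : conj_closed I ->
  (forall b c, I (E 0 b c 0)) -> (forall a, a + a = 0 -> I (E a 0 0 a)) ->
  forall x, mxtr x = 0 -> I x.
Proof.
move=> Ic Ioff Idiag x trx.
have [nx|] := boolP (nonscalar x).
  pose y := E 0 (- mxdet x) 1 0.
  apply: (@conj_closed_tr_det I y) => //.
  - by rewrite /nonscalar /y !cE oner_eq0 orbT.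
  - by rewrite trx /mxtr /y !cE addr0.
  - by rewrite {1}/mxdet /y !cE mul0r sub0r mulr1 opprK.
  - exact: Ioff.
move: trx; rewrite /nonscalar /mxtr !negb_or !negbK.
have [a [b [c [d ->]]]] := mxP x.
rewrite !cE => ad /and3P[/eqP-> /eqP-> /eqP eq_ad].
by move: ad; rewrite eq_ad => ?; apply: Idiag.
Qed.

End MatrixCoordinates.

(** * Images in matrix algebras *)

Section MatrixImage.
Variables (F : fieldType) (H : falgType F) (E : matrix_coords H).
Variables (m : nat) (lam : 'S_m -> F).
Local Notation f := (mleval (A := H) lam).
Local Notation fL := (mleval_multilin (A := H) lam).

Definition mlimage (x : H) : Prop := exists u, f u = x.

Lemma mlimage_conj : conj_closed mlimage.
Proof.
move=> z z' x zz' z'z [u <-].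
by exists (fun j => z * u j * z'); rewrite mleval_conj.
Qed.

Lemma mlimage_scale (k : F) x : (exists l : 'I_m, True) ->
  mlimage x -> mlimage (k *: x).
Proof.
move=> [l _] [u <-]; exists (upd u l (k *: u l)).
by rewrite (multilinZ fL) upd_id.
Qed.

Definition matrix_unit (x : H) : Prop :=
  [\/ x = E 1 0 0 0, x = E 0 1 0 0, x = E 0 0 1 0 | x = E 0 0 0 1].

Lemma matrix_unit_spanning : spanning matrix_unit.
Proof.
move=> S SB Slin x; have [a [b [c [d ->]]]] := mxP E x.
(* The last two terms cancel; they let the sum end in a matrix unit, as [lin_closed] requires. *)
have -> : E a b c d = a *: E 1 0 0 0 + (b *: E 0 1 0 0 + (c *: E 0 0 1 0 +
    (d *: E 0 0 0 1 + (-1 *: E 0 0 0 1 + E 0 0 0 1)))).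
  by rewrite !mxZ !mxD; congr (mx E); ring.
have [u1 u2 u3 u4] : [/\ matrix_unit (E 1 0 0 0), matrix_unit (E 0 1 0 0),
    matrix_unit (E 0 0 1 0) & matrix_unit (E 0 0 0 1)].
  by split; [apply: Or41|apply: Or42|apply: Or43|apply: Or44].
by do !(apply: (Slin); first exact: SB); apply: SB.
Qed.

(** The grading of the matrices with e12 in degree 1, e21 in degree -1 and the diagonal in degree 0:
    each entry vanishes unless [n] is its degree. *)
Definition weight (n : int) (x : H) : Prop :=
  [/\ c11 E x = 0 \/ n = 0, c12 E x = 0 \/ n = 1,
      c21 E x = 0 \/ n = -1 & c22 E x = 0 \/ n = 0].

Lemma weight0 n : weight n 0.
Proof. by rewrite -(mx0 E); split; left; rewrite cE. Qed.

Lemma weight_lin n : lin_closed (weight n).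
Proof.
move=> k x y; rewrite /weight.
have [a [b [c [d ->]]]] := mxP E x; have [a' [b' [c' [d' ->]]]] := mxP E y.
rewrite mx_linear !cE.
have lin (t t' : F) P : t = 0 \/ P -> t' = 0 \/ P -> k * t + t' = 0 \/ P.
  by move=> [-> [->|]|]; [left; rewrite mulr0 addr0|right|right].
by case=> ? ? ? ? [? ? ? ?]; split; apply: lin.
Qed.

Lemma weight1 : weight 0 1.
Proof. by rewrite -(mx_one E); split; rewrite !cE; tauto. Qed.

Lemma weight_mul n k x y : weight n x -> weight k y -> weight (n + k) (x * y).
Proof.
rewrite /weight.
have [a [b [c [d ->]]]] := mxP E x; have [a' [b' [c' [d' ->]]]] := mxP E y.
rewrite mx_mul !cE.
have two (t1 t1' t2 t2' : F) (n1 k1 n2 k2 N : int) :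
    t1 = 0 \/ n = n1 -> t1' = 0 \/ k = k1 -> t2 = 0 \/ n = n2 ->
    t2' = 0 \/ k = k2 -> n1 + k1 = N -> n2 + k2 = N ->
    t1 * t1' + t2 * t2' = 0 \/ n + k = N.
  case=> [->|->]; case=> [->|->]; case=> [->|->]; case=> [->|->] E1 E2;
    by [left; rewrite ?(mul0r, mulr0, addr0) | right].
by case=> ? ? ? ? [? ? ? ?]; split; apply: two; eauto.
Qed.

Lemma weight_eval d u : (forall j, weight (d j) (u j)) ->
  weight (\sum_j d j) (f u).
Proof.
by apply: mleval_graded; [exact: weight0|exact: weight_lin|exact: weight1|
  exact: weight_mul].
Qed.

Lemma matrix_unit_weight x : matrix_unit x -> exists n, weight n x.
Proof.
by case=> ->; [exists 0|exists 1|exists (-1)|exists 0]; split; rewrite cE; tauto.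
Qed.

(** The weight modulo 2: [false] stands for diagonal and [true] for off-diagonal matrices, with
    [addb] as the group law. *)
Definition mxs (s : bool) (p q : F) : H := if s then E 0 p q 0 else E p 0 0 q.
Definition parity (s : bool) (x : H) : Prop := exists p q, x = mxs s p q.

Lemma mxs_lin s k p q p' q' :
  k *: mxs s p q + mxs s p' q' = mxs s (k * p + p') (k * q + q').
Proof. by case: s; rewrite /= mx_linear; congr (mx E); ring. Qed.

Lemma mxs_eq0 s p q : (mxs s p q == 0) = (p == 0) && (q == 0).
Proof.
apply/eqP/andP => [|[/eqP-> /eqP->]]; last by case: s; rewrite /= mx0.
by rewrite -(mx0 E); case: s => /mx_inj[]=> *; split; apply/eqP.
Qed.

Lemma mxs0 s : mxs s 0 0 = 0.
Proof. by apply/eqP; rewrite mxs_eq0 eqxx. Qed.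

Lemma parity_inter s t x : parity s x -> parity t x -> x != 0 -> s = t.
Proof.
move=> [p [q ->]] [p' [q' e]]; rewrite mxs_eq0.
by case: s t e => [] [] //= /mx_inj[? ? ? ?]; subst; rewrite eqxx.
Qed.

Lemma parity_lin s : lin_closed (parity s).
Proof.
move=> k x y [p [q ->]] [p' [q' ->]].
by rewrite mxs_lin; exists (k * p + p'), (k * q + q').
Qed.

Lemma parity_eval t u : (forall j, parity (t j) (u j)) ->
  parity (\big[addb/false]_j t j) (f u).
Proof.
apply: mleval_graded; first by move=> s; exists 0, 0; rewrite mxs0.
- exact: parity_lin.
- by exists 1, 1; rewrite /= mx_one.
move=> s s' x y [p [q ->]] [p' [q' ->]].
case: s s' => [] []; rewrite /parity /= mx_mul ?(mul0r, mulr0, add0r, addr0).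
- by exists (p * q'), (q * p').
- by exists (p * q'), (q * p').
- by exists (p * p'), (q * q').
- by exists (p * p'), (q * q').
Qed.

Lemma matrix_unit_parity x : matrix_unit x -> exists s, parity s x.
Proof.
by case=> ->; [exists false, 1, 0|exists true, 1, 0|exists true, 0, 1|
  exists false, 0, 1].
Qed.

Local Notation swap := (E 0 1 1 0).

Lemma swapK : swap * swap = 1.
Proof. by rewrite mx_mul -(mx_one E); congr (mx E); ring. Qed.

Lemma swap_mxs s p q : swap * mxs s p q * swap = mxs s q p.
Proof. by case: s; rewrite /= !mx_mul; congr (mx E); ring. Qed.

Lemma parity_pencil s u p q : (forall j, exists t, parity t (u j)) ->
  f u = mxs s p q -> p ^+ 2 != q ^+ 2 ->
  exists u' l w1 w2, forall al be,
    f (upd u' l (al *: w1 + be *: w2)) = mxs s al be.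
Proof.
move=> /fin_all_exists[t ut] fu pq.
(* Conjugation by [swap] preserves parities and exchanges the two entries of the value, so [f u] and
   [f v] are not collinear. *)
pose v j := swap * u j * swap.
have vt j : parity (t j) (v j).
  by have [x [y e]] := ut j; exists y, x; rewrite /v e swap_mxs.
have fv : f v = mxs s q p by rewrite mleval_conj ?swapK // fu swap_mxs.
have fu0 : f u != 0.
  by rewrite fu mxs_eq0; apply: contraNN pq => /andP[/eqP-> /eqP->].
have fv0 : f v != 0 by move: fu0; rewrite fu fv !mxs_eq0 andbC.
have ncol k : f v <> k *: f u.
  rewrite fu fv -[k *: _]addr0.
  rewrite -(mxs0 s) mxs_lin !addr0 => e.
  have [qE pE] : q = k * p /\ p = k * q by case: s e {fu fv} => /mx_inj[].
  by case/eqP: pq; rewrite !expr2 {1}pE {2}qE; ring.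
have VD j x y : parity (t j) x -> parity (t j) y -> parity (t j) (x + y).
  by rewrite -{2}[x]scale1r; apply: parity_lin.
have [u' [l [y [Vu' Vy fu'0 ncol']]]] :=
  multilin_pencil fL VD ut vt fu0 fv0 ncol.
have par_s w : (forall j, parity (t j) (w j)) -> parity s (f w).
  move=> /parity_eval; have := parity_eval ut.
  have : parity s (f u) by exists p, q.
  by move=> /parity_inter st /st /(_ fu0) <-.
have [a [b fu'E]] := par_s _ Vu'.
have [c [d fyE]] := par_s _ (@upd_pred _ _ (fun j => parity (t j)) _ _ _ Vu' Vy).
have D0 : a * d - b * c != 0.
  apply/eqP => D0; have [a0|a0] := eqVneq a 0.
    have b0 : b != 0 by move: fu'0; rewrite fu'E mxs_eq0 a0 eqxx.
    apply: (ncol' (d / b)); rewrite fyE fu'E -[_ *: _]addr0.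
      have /eqP c0 : c == 0.
      by move/eqP: D0; rewrite a0 mul0r sub0r oppr_eq0 mulf_eq0 (negbTE b0).
    by rewrite -(mxs0 s) mxs_lin a0 c0 !addr0 mulr0 divfK.
  apply: (ncol' (c / a)); rewrite fyE fu'E -[_ *: _]addr0.
  rewrite -(mxs0 s) mxs_lin !addr0 divfK //; congr (mxs s c _).
  by apply: (mulfI a0); rewrite (subr0_eq D0); field.
have fmx a' b' : f (upd u' l (a' *: u' l + b' *: y)) =
    mxs s (a' * a + b' * c) (a' * b + b' * d).
  by rewrite fL (multilinZ fL) upd_id fu'E fyE -[b' *: _]addr0 -(mxs0 s) !mxs_lin
     !addr0.
(* The inverse of the matrix with rows [a, b] and [c, d]: in coordinate [l], [w1] and [w2] give the
   values [mxs s 1 0] and [mxs s 0 1]. *)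
pose w1 : H := (a * d - b * c)^-1 *: (d *: u' l + - b *: y).
pose w2 : H := (a * d - b * c)^-1 *: (- c *: u' l + a *: y).
exists u', l, w1, w2 => al be; rewrite /w1 /w2.
set D := a * d - b * c in D0 *.
have -> : al *: (D^-1 *: (d *: u' l + - b *: y)) +
    be *: (D^-1 *: (- c *: u' l + a *: y)) =
    (al / D * d - be / D * c) *: u' l + (be / D * a - al / D * b) *: y.
  rewrite !scalerA !scalerDr !scalerA addrACA -!scalerDl.
  by congr (_ *: _ + _ *: _); ring.
by rewrite fmx; congr (mxs s); rewrite /D; field.
Qed.

(** Conjugation by 1 + e12 or 1 + e21 destroys the parity of every homogeneous matrix that is not
    scalar. *)
Lemma scalar_of_conj_closed_parity (I : H -> Prop) s : conj_closed I ->
  (forall x, I x -> parity s x) -> forall x, I x -> exists k : F, x = k%:A.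
Proof.
move=> Ic Is.
have invE (t : F) : E 1 t 0 1 * E 1 (- t) 0 1 = 1 /\ E 1 0 t 1 * E 1 0 (- t) 1 = 1.
  by rewrite !mx_mul -(mx_one E); split; congr (mx E); ring.
have conj_up x : I x -> parity s (E 1 1 0 1 * x * E 1 (-1) 0 1).
  move=> Ix; apply/Is/Ic => //; first by have [] := invE 1.
  by have [] := invE (-1); rewrite opprK.
have conj_low x : I x -> parity s (E 1 0 1 1 * x * E 1 0 (-1) 1).
  move=> Ix; apply/Is/Ic => //; first by have [] := invE 1.
  by have [] := invE (-1); rewrite opprK.
move=> x Ix; have [p [q xE]] := Is x Ix.
have := conj_up x Ix; have := conj_low x Ix; rewrite xE.
case: s {Is conj_up conj_low xE} => -[a [b /=]]; rewrite !mx_mul.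
  move=> /mx_inj[e _ _ _] [a' [b' /mx_inj[e' _ _ _]]].
  exists 0; rewrite (mx_scalar E); congr (mx E); apply/eqP.
    by rewrite -oppr_eq0 -e; apply/eqP; ring.
  by rewrite -e'; apply/eqP; ring.
move=> /mx_inj[_ _ e _] _; exists p; rewrite (mx_scalar E); congr (mx E).
by apply/eqP; rewrite -subr_eq0 -oppr_eq0 -e; apply/eqP; ring.
Qed.

Lemma matrix_unit_value (P : H -> Prop) : lin_closed P ->
  ~ (forall u, P (f u)) ->
  exists u : 'I_m -> H, [/\ forall j, matrix_unit (u j), ~ P (f u) &
    exists n, weight n (f u)].
Proof.
move=> Plin nP; apply: contrapT => no; apply: nP.
apply: (multilin_ind fL matrix_unit_spanning Plin) => u uu.
apply: contrapT => nPu; apply: no; exists u; split=> //.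
have [d ud] := fin_all_exists (fun j => matrix_unit_weight (uu j)).
by exists (\sum_j d j); apply: weight_eval.
Qed.

Lemma units_parity (u : 'I_m -> H) : (forall j, matrix_unit (u j)) ->
  forall j, exists t, parity t (u j).
Proof. by move=> uu j; apply: matrix_unit_parity. Qed.

Lemma weightE n x : weight n x ->
  [\/ exists a d, x = E a 0 0 d, exists b, x = E 0 b 0 0 |
      exists c, x = E 0 0 c 0].
Proof.
rewrite /weight; have [a [b [c [d ->]]]] := mxP E x; rewrite !cE.
have [-> [_ [->|//] [->|//] _]|n0] := eqVneq n 0; first by apply: Or31; exists a, d.
case=> -[->|/eqP]; rewrite ?(negbTE n0) // => wb wc [->|/eqP]; rewrite ?(negbTE n0) //.
case: wb wc => [->|->]; first by move=> _; apply: Or33; exists c.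
by case=> [->|//]; apply: Or32; exists b.
Qed.

(** If all values at matrix units were diagonal, the whole image would be diagonal, and being closed
    under conjugation, scalar. So some value at matrix units is a nonzero multiple of e12 or e21, to
    which [parity_pencil] applies. *)
Lemma offdiag_pencil : ~ (forall u, exists k : F, f u = k%:A) ->
  exists u l w1 w2, forall al be,
    f (upd u l (al *: w1 + be *: w2)) = E 0 al be 0.
Proof.
move=> nsc.
have [] := @matrix_unit_value _ (@parity_lin false).
  move=> all0; apply: nsc => u.
  apply: (scalar_of_conj_closed_parity mlimage_conj (s := false)).
    by move=> _ [v <-].
  by exists u.
move=> u [/units_parity uu nP [n /weightE]].
case=> [[a [d e]]|[b e]|[c e]]; first by case: nP; exists a, d.
  apply: (parity_pencil (s := true) uu e); apply: contra_notN nP.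
  by rewrite expr0n sqrf_eq0 => /eqP b0; exists 0, 0; rewrite e b0.
apply: (parity_pencil (s := true) uu e); apply: contra_notN nP.
by rewrite expr0n eq_sym sqrf_eq0 => /eqP b0; exists 0, 0; rewrite e b0.
Qed.

(** For [a = d] the value is a nonzero scalar that can be rescaled. Otherwise [a ^+ 2 != d ^+ 2],
    and [parity_pencil] yields all diagonal matrices. *)
Lemma diag_value (u : 'I_m -> H) a d : (forall j, matrix_unit (u j)) -> f u = E a 0 0 d ->
  a + d != 0 \/ a != 0 /\ 2%:R = 0 :> F ->
  (exists l : 'I_m, True) -> forall k, mlimage (k%:A).
Proof.
move=> uu fu ad [l _] k; have [eq_ad|neq_ad] := eqVneq a d.
  have a0 : a != 0.
    case: ad => [|[]//]; rewrite -eq_ad; apply: contraNneq => ->.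
    by rewrite addr0.
  exists (upd u l ((k / a) *: u l)); rewrite (multilinZ fL) upd_id fu -eq_ad.
  by rewrite mxZ (mx_scalar E) mulr0 divfK.
have [|u' [l' [w1 [w2 fw]]]] := parity_pencil (s := false) (units_parity uu) fu.
  rewrite -subr_eq0 subr_sqr mulf_eq0 subr_eq0 negb_or neq_ad /=.
  case: ad => [//|[_ F2]]; apply: contraNneq neq_ad => ad0.
  rewrite -subr_eq0; have -> : a - d = a + d - 2%:R * d by ring.
  by rewrite ad0 F2 mul0r subrr.
by exists (upd u' l' (k *: w1 + k *: w2)); rewrite fw (mx_scalar E).
Qed.

Lemma scalar_or_traceless_sub : (exists l : 'I_m, True) ->
  (forall u, exists k : F, f u = k%:A) \/ (forall x, mxtr E x = 0 -> mlimage x).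
Proof.
move=> m0; have [?|nsc] := pselect (forall u, exists k : F, f u = k%:A).
  by left.
right; have [u [l [w1 [w2 fw]]]] := offdiag_pencil nsc.
have Ioff b c : mlimage (E 0 b c 0).
  by exists (upd u l (b *: w1 + c *: w2)); rewrite fw.
apply: (traceless_sub (E := E) mlimage_conj Ioff) => a aa.
have [->|a0] := eqVneq a 0; first exact: Ioff.
have F2 : 2%:R = 0 :> F by apply: (mulfI a0); rewrite mulr0 mulr_natr mulr2n.
(* In characteristic 2 the nonzero scalars are traceless too. The values are not all off-diagonal,
   so some tuple of matrix units has a nonzero diagonal value. *)
have [] := @matrix_unit_value _ (@parity_lin true).
  move=> all1; apply: nsc => v.
  apply: (scalar_of_conj_closed_parity mlimage_conj (s := true)).
    by move=> _ [v' <-].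
  by exists v.
move=> v [uv nP [n /weightE]].
case=> [[p [q e]]|[b e]|[c e]]; last 2 first.
- by case: nP; exists b, 0.
- by case: nP; exists 0, c.
have [p0|p0] := eqVneq p 0; last first.
  by rewrite -(mx_scalar E); apply: (diag_value uv e) => //; right.
rewrite -(mx_scalar E); apply: (diag_value uv e) => //; left.
rewrite p0 add0r; apply: contra_notN nP => /eqP q0.
by exists 0, 0; rewrite e p0 q0.
Qed.

Lemma traced_value : ~ (forall u, mxtr E (f u) = 0) ->
  exists (u : 'I_m -> H) a d, [/\ forall j, matrix_unit (u j), f u = E a 0 0 d & a + d != 0].
Proof.
move=> ntr.
have [|u [uu nP [n /weightE]]] := @matrix_unit_value (fun x => mxtr E x = 0) _ ntr.
  by move=> k x y x0 y0; rewrite mxtr_linear x0 y0 mulr0 addr0.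
case=> [[a [d e]]|[b e]|[c e]].
- by exists u, a, d; split=> //; apply: contra_notN nP => /eqP; rewrite e /mxtr !cE.
- by case: nP; rewrite e /mxtr !cE addr0.
- by case: nP; rewrite e /mxtr !cE addr0.
Qed.

End MatrixImage.

(** * Traced images away from characteristic 2 *)

(** Replaces the argument that a nonzero square stays one under a small generic change; it covers
    both real closed fields and quadratically closed fields of characteristic not 2. *)
Definition square_perturbation (F : fieldType) : Prop :=
  forall D T : {poly F}, T != 0 -> (exists2 s, s != 0 & D.[0] = s ^+ 2) ->
  exists2 t, T.[t] != 0 & exists2 s, s != 0 & D.[t] = s ^+ 2.

(* The form q(x) = (a - d)^2 + 4bc - k(a + d)^2 vanishes on a matrix exactly
   when discriminant = k trace^2. *)
Definition discform (F : fieldType) (k a b c d : F) : F :=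
  (a - d) ^+ 2 + 4%:R * b * c - k * (a + d) ^+ 2.

(** The polar form of [discform], that is q(x + y) - q(x) - q(y). *)
Definition discpolar (F : fieldType) (k a b c d a' b' c' d' : F) : F :=
  2%:R * (a - d) * (a' - d') + 4%:R * (b * c' + b' * c)
    - 2%:R * k * (a + d) * (a' + d').

(* The two isotropic vectors of a binary form of nonzero square discriminant
   differ by a multiple of the first basis vector, so one of them is traced. *)
Lemma traced_isotropic (F : fieldType) (k s a b c d a' b' c' d' : F) :
  2%:R != 0 :> F -> s != 0 -> a + d != 0 ->
  discpolar k a b c d a' b' c' d' ^+ 2
    - 4%:R * discform k a b c d * discform k a' b' c' d' = s ^+ 2 ->
  exists x y, let a0 := x * a + y * a' in let b0 := x * b + y * b' in
    let c0 := x * c + y * c' in let d0 := x * d + y * d' in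
    [/\ a0 + d0 != 0, discform k a0 b0 c0 d0 = 0 &
        [|| b0 != 0, c0 != 0 | a0 != d0]].
Proof.
move=> F2 s0 ad DE.
suff [x [y [tr0 q0]]] : exists x y,
    (x * a + y * a') + (x * d + y * d') != 0 /\
    discform k (x * a + y * a') (x * b + y * b') (x * c + y * c')
      (x * d + y * d') = 0.
  (* If the traced isotropic vector were scalar, then [k = 0] and the vector would lie in the
     radical of the form on the plane, against the nonzero discriminant [s ^+ 2]. *)
  exists x, y => /=; split=> //; apply: contraNT s0.
  rewrite !ssrbool.negb_or !negbK => /and3P[/eqP b0 /eqP c0 /eqP ad0].
  have k0 : k = 0.
    have /eqP : k * ((x * a + y * a') + (x * d + y * d')) ^+ 2 = 0.
      by rewrite -[RHS]oppr0 -q0 /discform b0 c0 ad0; ring.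
    by rewrite mulf_eq0 sqrf_eq0 (negbTE tr0) orbF => /eqP.
  have polar1 : 2%:R * x * discform k a b c d
      + y * discpolar k a b c d a' b' c' d' = 0.
    transitivity (2%:R * (a - d) * ((x * a + y * a') - (x * d + y * d'))
      + 4%:R * (b * (x * c + y * c') + c * (x * b + y * b'))).
      by rewrite /discform /discpolar k0; ring.
    by rewrite b0 c0 ad0; ring.
  have polar2 : x * discpolar k a b c d a' b' c' d'
      + 2%:R * y * discform k a' b' c' d' = 0.
    transitivity (2%:R * (a' - d') * ((x * a + y * a') - (x * d + y * d'))
      + 4%:R * (b' * (x * c + y * c') + c' * (x * b + y * b'))).
      by rewrite /discform /discpolar k0; ring.
    by rewrite b0 c0 ad0; ring.
  rewrite -sqrf_eq0 -DE; set B := discpolar _ _ _ _ _ _ _ _ _ in polar1 polar2 *.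
  set Q := discform _ _ _ _ _ in polar1 *.
  set Q' := discform _ _ _ _ _ in polar2 *.
  have xD : x * (B ^+ 2 - 4%:R * Q * Q') = 0.
    transitivity ((x * B + 2%:R * y * Q') * B
      - 2%:R * Q' * (2%:R * x * Q + y * B)); first by ring.
    by rewrite polar1 polar2; ring.
  have yD : y * (B ^+ 2 - 4%:R * Q * Q') = 0.
    transitivity ((2%:R * x * Q + y * B) * B
      - 2%:R * Q * (x * B + 2%:R * y * Q')); first by ring.
    by rewrite polar1 polar2; ring.
  apply: contraNT tr0 => D0.
  move/eqP: xD; rewrite mulf_eq0 (negbTE D0) orbF => /eqP->.
  move/eqP: yD; rewrite mulf_eq0 (negbTE D0) orbF => /eqP->.
  by rewrite !mul0r !addr0.
have qE x y : discform k (x * a + y * a') (x * b + y * b') (x * c + y * c')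
    (x * d + y * d') = x ^+ 2 * discform k a b c d
    + x * y * discpolar k a b c d a' b' c' d' + y ^+ 2 * discform k a' b' c' d'.
  by rewrite /discform /discpolar; ring.
move: DE qE; set B := discpolar _ _ _ _ _ _ _ _ _.
set Q := discform _ a b c d; set Q' := discform _ _ _ _ _ => DE qE.
have [Q0|Q0] := eqVneq Q 0.
  by exists 1, 0; rewrite qE !mul1r !mul0r !addr0 Q0; split=> //; ring.
(* The quadratic formula in homogeneous form, [e] being either square root of the discriminant. *)
have iso e : e ^+ 2 = s ^+ 2 -> discform k ((- B + e) * a + (2%:R * Q) * a')
    ((- B + e) * b + (2%:R * Q) * b') ((- B + e) * c + (2%:R * Q) * c')
    ((- B + e) * d + (2%:R * Q) * d') = 0.
  move=> es; rewrite qE; transitivity (Q * (e ^+ 2 - (B ^+ 2 - 4%:R * Q * Q'))).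
    by ring.
  by rewrite es DE subrr mulr0.
have [tr0|tr0] := eqVneq (((- B + s) * a + (2%:R * Q) * a')
    + ((- B + s) * d + (2%:R * Q) * d')) 0; last first.
  by exists (- B + s), (2%:R * Q); split=> //; apply: iso.
exists (- B - s), (2%:R * Q); split; last by apply: iso; rewrite sqrrN.
have -> : ((- B - s) * a + (2%:R * Q) * a') + ((- B - s) * d + (2%:R * Q) * d')
    = - (2%:R * s * (a + d)).
  by rewrite -[RHS]add0r -tr0; ring.
by rewrite oppr_eq0 !mulf_neq0.
Qed.

Section OddCharacteristic.
Variables (F : fieldType) (H : falgType F) (E : matrix_coords H).
Variables (m : nat) (lam : 'S_m -> F).
Local Notation f := (mleval (A := H) lam).
Local Notation fL := (mleval_multilin (A := H) lam).

(* Perturb a pencil with values E 0 * * 0, on which the discriminant form is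
   hyperbolic, in the direction of a point v with traced value. *)
Lemma full_image_odd : 2%:R != 0 :> F -> square_perturbation F ->
  (exists l : 'I_m, True) ->
  ~ (forall u, exists k : F, f u = k%:A) -> ~ (forall u, mxtr E (f u) = 0) ->
  forall x : H, mlimage lam x.
Proof.
move=> F2 sqF m0 nsc ntr x.
have [v [av [dv [uv fv adv]]]] := traced_value ntr.
have [trx|trx] := eqVneq (mxtr E x) 0.
  by have [?|] := scalar_or_traceless_sub E lam m0; last exact.
have [nsx|] := boolP (nonscalar E x); last first.
  rewrite /nonscalar !ssrbool.negb_or !negbK => /and3P[/eqP b0 /eqP c0 /eqP ad].
  rewrite -(mx_coords E x) b0 c0 -ad -(mx_scalar E).
  by apply: (diag_value uv fv) => //; left.
have [u [l [w1 [w2 fw]]]] := offdiag_pencil E nsc.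
pose X t := f (fun j => upd u l w1 j + t *: v j).
(* With coordinate [l] of the direction set to 0, the tuples for [X t] and [Y t] differ only in [l],
   so their span lies in the image. *)
pose Y t := f (fun j => upd u l w2 j + t *: upd v l 0 j).
have XY t al be : mlimage lam (al *: X t + be *: Y t).
  pose U : 'I_m -> H := fun j => u j + t *: v j.
  exists (upd U l (al *: (w1 + t *: v l) + be *: w2)).
  rewrite fL (multilinZ fL); congr (_ *: f _ + _ *: f _).
    by apply/funext => j; rewrite /upd; case: eqP => // ->.
  by apply/funext => j; rewrite /upd /U; case: eqP; rewrite ?scaler0 ?addr0.
have X0 : X 0 = E 0 1 0 0.
  rewrite -[RHS](fw 1 0) /X; congr f; apply/funext => j.
  by rewrite scale0r addr0 scale1r scale0r addr0.
have Y0 : Y 0 = E 0 0 1 0.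
  rewrite -[RHS](fw 0 1) /Y; congr f; apply/funext => j.
  by rewrite scale0r addr0 scale1r scale0r add0r.
have lin : [/\ forall c y z, c11 E (c *: y + z) = c * c11 E y + c11 E z,
    forall c y z, c12 E (c *: y + z) = c * c12 E y + c12 E z,
    forall c y z, c21 E (c *: y + z) = c * c21 E y + c21 E z &
    forall c y z, c22 E (c *: y + z) = c * c22 E y + c22 E z].
  by split=> c y z; have [? [? [? [? ->]]]] := mxP E y;
     have [? [? [? [? ->]]]] := mxP E z; rewrite mx_linear !cE.
case: lin => lin11 lin12 lin21 lin22.
have [a [am aE]] := multilin_line fL lin11 (upd u l w1) v.
have [b [_ bE]] := multilin_line fL lin12 (upd u l w1) v.
have [c [_ cE']] := multilin_line fL lin21 (upd u l w1) v.
have [d [dm dE]] := multilin_line fL lin22 (upd u l w1) v.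
have [a' [_ aE']] := multilin_line fL lin11 (upd u l w2) (upd v l 0).
have [b' [_ bE']] := multilin_line fL lin12 (upd u l w2) (upd v l 0).
have [c' [_ cE'']] := multilin_line fL lin21 (upd u l w2) (upd v l 0).
have [d' [_ dE']] := multilin_line fL lin22 (upd u l w2) (upd v l 0).
(* For this ratio, a traced zero of [discform k] has the same det / tr^2 as the target [x]. *)
pose k := (mxtr E x ^+ 2 - 4%:R * mxdet E x) / mxtr E x ^+ 2.
pose q (a b c d : {poly F}) : {poly F} :=
  (a - d) ^+ 2 + 4%:R%:P * b * c - k%:P * (a + d) ^+ 2.
pose B : {poly F} := 2%:R%:P * (a - d) * (a' - d')
  + 4%:R%:P * (b * c' + b' * c) - 2%:R%:P * k%:P * (a + d) * (a' + d').
pose D : {poly F} := B ^+ 2 - 4%:R%:P * q a b c d * q a' b' c' d'.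
have DE t : D.[t] = discpolar k a.[t] b.[t] c.[t] d.[t] a'.[t] b'.[t] c'.[t] d'.[t] ^+ 2
    - 4%:R * discform k a.[t] b.[t] c.[t] d.[t]
      * discform k a'.[t] b'.[t] c'.[t] d'.[t].
  by rewrite /D /B /q /discpolar /discform !hornerE.
(* The coefficient of degree [m] is the trace of [f v], which is nonzero. *)
have T0 : a + d != 0.
  apply: contraNneq adv => ad0.
  have := congr1 (fun p : {poly F} => p`_m) ad0.
  by rewrite poly.coefD am dm fv !cE coef0 => ->.
(* At [t = 0] the plane is spanned by e12 and e21, where the form is 4bc with discriminant 16. *)
have D0 : exists2 s, s != 0 & D.[0] = s ^+ 2.
  exists 4%:R; first by rewrite (_ : 4%:R = 2%:R * 2%:R) ?mulf_neq0 // -natrM.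
  rewrite DE aE bE cE' dE aE' bE' cE'' dE' -/(X 0) -/(Y 0) X0 Y0 !cE.
  by rewrite /discpolar /discform; ring.
have [t Tt [s s0 Ds]] := sqF D (a + d) T0 D0.
rewrite DE in Ds; rewrite hornerD in Tt.
have [al [be]] := traced_isotropic F2 s0 Tt Ds.
rewrite aE bE cE' dE aE' bE' cE'' dE' -/(X t) -/(Y t) /= => -[].
have := XY t al be; rewrite -(mx_coords E (X t)) -(mx_coords E (Y t)) !cE.
rewrite !mxZ mxD; set a0 := _ + _ : F; set b0 := _ + _; set c0 := _ + _.
set d0 := _ + _ => Iz tr0 q0 ns0; pose r := mxtr E x / (a0 + d0).
have r0 : r != 0 by rewrite mulf_neq0 ?invr_eq0.
have rE : r = mxtr E x / (a0 + d0) by [].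
clearbody r.
have [w fwE] := Iz.
apply: (@conj_closed_tr_det _ _ E _ (E (r * a0) (r * b0) (r * c0) (r * d0)) _
  (@mlimage_conj _ _ _ _)) => //.
- rewrite /nonscalar !cE !mulf_eq0 (negbTE r0) /= (inj_eq (mulfI r0)).
  exact: ns0.
- by rewrite {1}/mxtr !cE -mulrDr rE divfK.
- apply: (mulfI (_ : 4%:R != 0 :> F)).
    by rewrite (_ : 4%:R = 2%:R * 2%:R) ?mulf_neq0 // -natrM.
  transitivity (r ^+ 2 * ((1 - k) * (a0 + d0) ^+ 2 - discform k a0 b0 c0 d0)).
    by rewrite /mxdet !cE /discform; ring.
  by rewrite q0 rE /k; field; rewrite trx tr0.
- have [l0 _] := m0; exists (upd w l0 (r *: w l0)).
  by rewrite (multilinZ fL) upd_id fwE mxZ.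
Qed.

End OddCharacteristic.

(** * Traced images in characteristic 2 *)

(* A quadratic equation over a perfect field of characteristic 2 is solvable
   in two variables once some direction carries a square but no linear term. *)
Lemma char2_solve (F : fieldType) (I : finType) (tau kap gam : F)
    (a c : I -> F) (c2 : I -> I -> F) :
  2%:R = 0 :> F -> quadratically_closed F -> tau != 0 -> kap != 0 ->
  \sum_j c j = tau -> \sum_j a j = kap ->
  (exists j t, (t * a j) ^+ 2 + t * a j * tau + kap * (t * c j) = gam) \/
  (exists j k t r, j != k /\
     (t * a j + r * a k) ^+ 2 + (t * a j + r * a k) * tau
     + kap * (t * c j + r * c k + t * r * c2 j k) = gam).
Proof.
move=> F2 sqF tau0 kap0 sum_c sum_a.
have double (x : F) : x + x = 0 by rewrite -mulr2n -mulr_natl F2 mul0r.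
(* The linear coefficient in [t] when only [j] moves; if it vanishes, a square root solves the
   equation. *)
pose mu j := a j * tau + kap * c j.
have [j cj] : exists j, c j != 0.
  apply: contrapT => no; case/eqP: tau0; rewrite -sum_c big1 // => j _.
  by apply/eqP; apply: contrapT => /negP cj; apply: no; exists j.
have [mu0|mu0] := eqVneq (mu j) 0.
  have aj : a j != 0.
    apply: contraNneq cj => aj0; move/eqP: mu0.
    by rewrite /mu aj0 mul0r add0r mulf_eq0 (negbTE kap0).
  have [s sE] := sqF gam; left; exists j, (s / a j).
  transitivity (s ^+ 2 + s / a j * mu j); first by rewrite /mu; field.
  by rewrite mu0 mulr0 addr0.
have [aj0|aj0] := eqVneq (a j) 0.
  by left; exists j, (gam / (kap * c j)); rewrite aj0; field; apply/andP.
(* Otherwise summing over [k] gives [c j * kap = tau * a j], hence [mu j = 0] in characteristic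
   2. *)
have [k jk] : exists k, c j * a k != c k * a j.
  apply: contrapT => no; case/eqP: mu0.
  suff e : c j * kap = tau * a j.
    by rewrite /mu mulrC -e mulrC double.
  rewrite -sum_a -sum_c mulr_sumr mulr_suml; apply: eq_bigr => k _.
  by apply/eqP; apply: contrapT => /negP ne; apply: no; exists k.
have neq_jk : j != k by apply: contraNneq jk => <-; rewrite mulrC.
right; exists j, k; have [c0|c0] := eqVneq (c2 j k) 0.
  have D0 : a j * mu k + a k * mu j != 0.
    have -> : a j * mu k + a k * mu j = kap * (c j * a k - c k * a j)
        + (a j * a k * tau + kap * c k * a j
        + (a j * a k * tau + kap * c k * a j)) by rewrite /mu; ring.
    by rewrite double addr0 mulf_neq0 // subr_eq0.
  have [s sE] := sqF gam.
  (* The direction [(mu k, mu j)] cancels the linear terms, and the scaling makes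
     [t * a j + r * a k] equal to [s]. *)
  exists (s * mu k / (a j * mu k + a k * mu j)),
    (s * mu j / (a j * mu k + a k * mu j)); split=> //.
  transitivity (s ^+ 2 + (s * mu j * mu k / (a j * mu k + a k * mu j)
      + s * mu j * mu k / (a j * mu k + a k * mu j))).
    by rewrite c0; move: D0; rewrite /mu => D0; field.
  by rewrite double addr0.
(* This [r] cancels the total coefficient of [t], which becomes [mu j + mu j]. *)
pose r := mu j / (kap * c2 j k).
have [s sE] := sqF (gam - (r * a k) ^+ 2 - r * mu k).
exists (s / a j), r; split=> //.
have rE : kap * c2 j k * r = mu j by rewrite /r; field; apply/andP.
transitivity (s ^+ 2 + (r * a k) ^+ 2 + r * mu k + s / a j * (mu j + kap * c2 j k * r)
  + (s * r * a k + s * r * a k)); first by rewrite /mu; field.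
by rewrite rE !double mulr0 !addr0 sE; ring.
Qed.

Section CharacteristicTwo.
Variables (F : fieldType) (H : falgType F) (E : matrix_coords H).
Variables (m : nat) (lam : 'S_m -> F).
Local Notation f := (mleval (A := H) lam).
Local Notation fL := (mleval_multilin (A := H) lam).
Hypothesis F2 : 2%:R = 0 :> F.

Lemma char2_double (x : F) : x + x = 0.
Proof. by rewrite -mulr2n -mulr_natl F2 mul0r. Qed.

Lemma char2_opp (x : F) : - x = x.
Proof. by apply/eqP; rewrite eq_sym -addr_eq0 char2_double. Qed.

(* The basis 1, e11, e12, e21 is indexed so that, modulo 2, the commutator with
   e12 (resp. e21) raises the first (resp. second) bit, or kills the element. *)
Definition bit_basis (c : bool * bool) : H :=
  match c with
  | (true, true) => E 1 0 0 1
  | (false, false) => E 1 0 0 0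
  | (true, false) => E 0 1 0 0
  | (false, true) => E 0 0 1 0
  end.

Definition nilp (s : bool) : H := if s then E 0 1 0 0 else E 0 0 1 0.

Definition raise_bit (s : bool) (c : bool * bool) : bool * bool :=
  if s then (true, c.2) else (c.1, true).

Definition bit (s : bool) (c : bool * bool) : bool := if s then c.1 else c.2.

Definition sgn (s : bool) : int := if s then 1 else -1.

Definition bit_weight (c : bool * bool) : int := c.1%:Z - c.2%:Z.

Lemma nilp_commutator s c : nilp s * bit_basis c - bit_basis c * nilp s =
  if bit s c then 0 else bit_basis (raise_bit s c).
Proof.
by case: s; case: c => [] [] []; rewrite /= !mx_mul mxB -?(mx0 E);
   congr (mx E); rewrite ?(mul0r, mulr0, mulr1, add0r, addr0, subr0, subrr)
     ?char2_opp.
Qed.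

Lemma bit_basis_weight c : weight E (bit_weight c) (bit_basis c).
Proof. by case: c => [] [] []; split; rewrite /= !cE; auto. Qed.

Lemma bit_basis_spanning : spanning (fun x => exists c, x = bit_basis c).
Proof.
move=> S SB Slin; apply: (matrix_unit_spanning (E := E)) => // x.
have S00 : S (E 0 0 0 1).
  have -> : E 0 0 0 1 = -1 *: E 1 0 0 0 + E 1 0 0 1.
    by rewrite mx_linear; congr (mx E); ring.
  by apply: Slin; apply: SB; [exists (false, false)|exists (true, true)].
by case=> -> //; apply: SB; [exists (false, false)|exists (true, false)|
  exists (false, true)].
Qed.

Definition config (c : {ffun 'I_m -> bool * bool}) : 'I_m -> H :=
  fun j => bit_basis (c j).

Definition height (c : {ffun 'I_m -> bool * bool}) : nat :=
  (\sum_j ((c j).1 + (c j).2))%N.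

Definition config_weight (c : {ffun 'I_m -> bool * bool}) : int :=
  \sum_j bit_weight (c j).

(** The first alternative covers tuples in which a commutator has killed an entry; [f] vanishes
    there, so every weight and height may be claimed. *)
Definition reached (n : int) (h : nat) (u : 'I_m -> H) : Prop :=
  (exists j, u j = 0) \/
  (exists c, [/\ u = config c, config_weight c = n & height c = h]).

Definition ad (s : bool) (j : 'I_m) (u : 'I_m -> H) : 'I_m -> H :=
  upd u j (nilp s * u j - u j * nilp s).

Lemma reached_ad s j n h u :
  reached n h u -> reached (n + sgn s) h.+1 (ad s j u).
Proof.
case=> [[k uk]|[c [-> <- <-]]].
  left; exists k; rewrite /ad /upd; case: eqP => // <-.
  by rewrite uk mulr0 mul0r subrr.
rewrite /ad nilp_commutator; case: ifP => [_|cj].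
  by left; exists j; rewrite upd_same.
right; exists [ffun k => if k == j then raise_bit s (c j) else c k]; split.
- by apply/funext => k; rewrite /upd /config ffunE; case: eqP.
- rewrite /config_weight (bigD1 j) // [in RHS](bigD1 j) //= ffunE eqxx.
  have -> : bit_weight (raise_bit s (c j)) = bit_weight (c j) + sgn s.
    by move: cj; case: (c j) => [[] []]; case: (s).
  rewrite (eq_bigr (fun k => bit_weight (c k))); first exact: addrAC.
  by move=> k kj; rewrite ffunE (negbTE kj).
- rewrite /height (bigD1 j) // [in RHS](bigD1 j) //= ffunE eqxx -addSn.
  congr (_ + _)%N; first by move: cj; case: (c j) => [[] []]; case: (s).
  by apply: eq_bigr => k kj; rewrite ffunE (negbTE kj).
Qed.

Lemma multilin_zero u j : u j = 0 -> f u = 0.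
Proof. by move=> uj; rewrite -(upd_id u j) uj (multilin0 fL). Qed.

Lemma reached_weight n h u : reached n h u -> weight E n (f u).
Proof.
case=> [[j /multilin_zero ->]|[c [-> <- _]]]; first exact: weight0.
by apply: weight_eval => j; apply: bit_basis_weight.
Qed.

Lemma weight_values n x : weight E n x ->
  [/\ n = 0 -> exists a d, x = E a 0 0 d, n = 1 -> exists b, x = E 0 b 0 0,
      n = -1 -> exists c, x = E 0 0 c 0 & n = -2 -> x = 0].
Proof.
rewrite /weight; have [a [b [c [d ->]]]] := mxP E x; rewrite !cE.
case=> ha hb hc hd; split=> ne; move: ha hb hc hd; rewrite ne -?(mx0 E).
- by move=> _ [->|//] [->|//] _; exists a, d.
- by move=> [->|//] _ [->|//] [->|//]; exists b.
- by move=> [->|//] [->|//] _ [->|//]; exists c.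
- by move=> [->|//] [->|//] [->|//] [->|//].
Qed.

(** The first-order part in [t] of conjugating the single entry [u j] by [1 + t *: nilp s]. *)
Definition shift (s : bool) (t : F) (j : 'I_m) (u : 'I_m -> H) : 'I_m -> H :=
  upd u j (u j + t *: (nilp s * u j - u j * nilp s)).

Lemma eval_shift s t j u : f (shift s t j u) = f u + t *: f (ad s j u).
Proof. by rewrite /shift (multilinD fL) upd_id (multilinZ fL). Qed.

Lemma ad_shift s s' t j k u : j != k ->
  ad s j (shift s' t k u) = shift s' t k (ad s j u).
Proof.
move=> jk; rewrite /ad /shift updC 1?eq_sym //.
by rewrite !upd_other // eq_sym.
Qed.

Lemma eval_shift2 s s' t r j k u : j != k ->
  f (shift s r k (shift s' t j u)) = f u + t *: f (ad s' j u)
    + r *: f (ad s k u) + (t * r) *: f (ad s' j (ad s k u)).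
Proof.
move=> jk; have kj : k != j by rewrite eq_sym.
rewrite eval_shift (ad_shift _ _ _ _ kj) !eval_shift scalerDr scalerA.
by rewrite (mulrC r) !addrA.
Qed.

Lemma shift_upd s t j u i x :
  shift s t j (upd u i x) = upd (shift s t j u) i
    (if i == j then x + t *: (nilp s * x - x * nilp s) else x).
Proof.
rewrite /shift; have [->|ij] := eqVneq i j; first by rewrite !upd_same !upd_upd.
by rewrite updC // (upd_other _ _ (_ : j != i)) // eq_sym.
Qed.

Lemma multilin_shift (g : ('I_m -> H) -> H) s t j :
  multilin g -> multilin (fun u => g (shift s t j u)).
Proof.
move=> gL u l c x y; rewrite !shift_upd -gL; congr (g (upd _ _ _)).
case: eqP => // _.
rewrite [c *: (x + _)]scalerDr scalerA [c * t]mulrC -scalerA addrACA -scalerDr.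
congr (_ + _ *: _); rewrite mulrDr mulrDl opprD addrACA.
by rewrite -scalerAr -scalerAl -scalerBr.
Qed.

(* Start from a configuration x of maximal height with traced value: raising
   any two of its entries then makes the trace vanish. *)
Lemma full_image_char2 : quadratically_closed F -> (exists l : 'I_m, True) ->
  ~ (forall u, exists k : F, f u = k%:A) -> ~ (forall u, mxtr E (f u) = 0) ->
  forall y : H, mlimage lam y.
Proof.
move=> sqF m0 nsc ntr z.
have [trz|trz] := eqVneq (mxtr E z) 0.
  by have [?|] := scalar_or_traceless_sub E lam m0; last exact.
have [c0 trc0] : exists c0, mxtr E (f (config c0)) != 0.
  apply: contrapT => no; apply: ntr => u.
  apply: (multilin_ind fL bit_basis_spanning (P := fun y => mxtr E y = 0)).
    by move=> k y y' ty ty'; rewrite mxtr_linear ty ty' mulr0 addr0.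
  move=> v /fin_all_exists[c vE]; apply/eqP; apply: contrapT => /negP trv.
  apply: no; exists [ffun j => c j]; apply: contraNneq trv => <-.
  by apply/eqP; congr (mxtr E (f _)); apply/funext => j; rewrite /config ffunE.
pose traced c := mxtr E (f (config c)) != 0.
have [c trc cmax] := @arg_maxnP _ c0 traced height trc0.
rewrite /traced in trc cmax; set x := config c in trc.
have max_tr n h u : reached n h u -> (height c < h)%N -> mxtr E (f u) = 0.
  case=> [[j /multilin_zero ->]|[c' [-> _ <-]]] lt_h.
    by rewrite -(mx0 E) /mxtr !cE addr0.
  by apply/eqP; apply: contraTT lt_h => /cmax; rewrite -leqNgt.
have Rx : reached 0 (height c) x.
  have Rx : reached (config_weight c) (height c) x by right; exists c.
  suff <- : config_weight c = 0 by [].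
  have [[w11|//] _ _ [w22|//]] := reached_weight Rx.
  by case/eqP: trc; rewrite /mxtr w11 w22 addr0.
have [a [b fx]] : exists a b, f x = E a 0 0 b.
  by have [/(_ erefl)] := weight_values (reached_weight Rx).
pose tau := a + b; have tau0 : tau != 0 by move: trc; rewrite fx /mxtr !cE.
(* By the Leibniz rule these values add up to the commutator of e12 with [f x], which is [tau] times
   e12. *)
have [i fi] : exists i, f (ad true i x) != 0.
  apply: contrapT => no; case/eqP: tau0.
  have := mleval_leibniz lam (nilp true) x; rewrite big1 => [|i _].
    rewrite fx /= !mx_mul mxB -(mx0 E) => /mx_inj[_ e _ _].
    by rewrite /tau addrC -[a]char2_opp [RHS]e; ring.
  by apply/eqP; apply: contrapT => /negP fi; apply: no; exists i.
set y := ad true i x in fi.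
have Ry : reached 1 (height c).+1 y := reached_ad true i Rx.
have [kap fy] : exists kap, f y = E 0 kap 0 0.
  by have [_ /(_ erefl)] := weight_values (reached_weight Ry).
have kap0 : kap != 0 by apply: contraNneq fi => e; rewrite fy e mx0.
have [c' fx'] : exists c' : 'I_m -> F, forall j, f (ad false j x) = E 0 0 (c' j) 0.
  apply: (@fin_all_exists _ _ (fun j t => f (ad false j x) = E 0 0 t 0)) => j.
  by have [_ _ /(_ erefl)] := weight_values (reached_weight (reached_ad false j Rx)).
(* By maximality of the height the trace vanishes, so in characteristic 2 this diagonal value is
   scalar. *)
have [a' fy'] : exists a' : 'I_m -> F, forall j, f (ad false j y) = E (a' j) 0 0 (a' j).
  apply: (@fin_all_exists _ _ (fun j t => f (ad false j y) = E t 0 0 t)) => j.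
  have Rj := reached_ad false j Ry.
  have [/(_ erefl) [p [q e]] _ _ _] := weight_values (reached_weight Rj).
  exists p; rewrite e; congr (mx E); have := max_tr _ _ _ Rj (leqnSn _).
  by rewrite e /mxtr !cE => /eqP; rewrite addr_eq0 char2_opp => /eqP.
(* The value has weight -2, which only 0 has. *)
have fx'' j k : f (ad false j (ad false k x)) = 0.
  have [_ _ _] := weight_values
    (reached_weight (reached_ad false j (reached_ad false k Rx))).
  exact.
have [c2 fy''] : exists c2 : 'I_m -> 'I_m -> F, forall j k,
    f (ad false j (ad false k y)) = E 0 0 (c2 j k) 0.
  apply: (@fin_all_exists _ _ (fun j t => forall k,
    f (ad false j (ad false k y)) = E 0 0 (t k) 0)) => j.
  apply: (@fin_all_exists _ _ (fun k t =>
    f (ad false j (ad false k y)) = E 0 0 t 0)) => k.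
  by have [_ _ /(_ erefl)] := weight_values
    (reached_weight (reached_ad false j (reached_ad false k Ry))).
have sumE (I : finType) (g h : I -> F) :
    \sum_j E (h j) 0 (g j) (h j) = E (\sum_j h j) 0 (\sum_j g j) (\sum_j h j).
  elim: (index_enum I) => [|j s IHs]; first by rewrite !big_nil mx0.
  by rewrite !big_cons IHs mxD !addr0.
have sum_c : \sum_j c' j = tau.
  have := mleval_leibniz lam (nilp false) x; rewrite (eq_bigr _ (fun j _ => fx' j)).
  have -> : \sum_j E 0 0 (c' j) 0 = E 0 0 (\sum_j c' j) 0.
    by rewrite (sumE _ c' (fun=> 0)) !big1_eq.
  rewrite fx /= !mx_mul mxB => /mx_inj[_ _ -> _].
  by rewrite /tau -[in RHS](char2_opp b); ring.
have sum_a : \sum_j a' j = kap.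
  have := mleval_leibniz lam (nilp false) y; rewrite (eq_bigr _ (fun j _ => fy' j)).
  rewrite (sumE _ (fun=> 0) a') fy /= !mx_mul mxB => /mx_inj[-> _ _ _].
  by rewrite -[RHS]char2_opp; ring.
pose r := mxtr E z / tau.
have r0 : r != 0 by rewrite mulf_neq0 ?invr_eq0.
have rE : r * tau = mxtr E z by rewrite /r divfK.
clearbody r.
have nonscalar_tr w : mxtr E w != 0 -> nonscalar E w.
  apply: contraNT; rewrite /nonscalar !ssrbool.negb_or !negbK => /and3P[_ _ /eqP ad].
  by rewrite /mxtr -ad char2_double.
(* The quadratic condition says that the determinant of [f w] is [mxdet E z / r ^+ 2]; scaling by
   [r] then matches both trace and determinant of [z]. *)
have suff_v w v t : f w = E (a + v) kap t (b + v) ->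
    v ^+ 2 + v * tau + kap * t = mxdet E z / r ^+ 2 + a * b -> mlimage lam z.
  move=> fw ve; have tr_w : mxtr E (r *: f w) = mxtr E z.
    rewrite fw mxZ /mxtr !cE -/(mxtr E z) -rE -[RHS]addr0 -(char2_double (r * v)).
    by rewrite /tau; ring.
  apply: (@conj_closed_tr_det _ _ E _ (r *: f w) _ (@mlimage_conj _ _ _ _)).
  - by apply: nonscalar_tr; rewrite tr_w.
  - exact: nonscalar_tr.
  - exact: tr_w.
  - rewrite fw mxZ {1}/mxdet !cE -[LHS]addr0 -(char2_double (r ^+ 2 * (kap * t))).
    transitivity (r ^+ 2 * ((v ^+ 2 + v * tau + kap * t) + a * b)).
      by rewrite /tau; ring.
    by rewrite ve -addrA char2_double addr0 mulrC divfK // expf_neq0.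
  - have [l0 _] := m0; exists (upd w l0 (r *: w l0)).
    by rewrite (multilinZ fL) upd_id.
(* Here [f U = f x + f y = E a kap 0 b]; shifts along e21 add [v] to both diagonal entries and leave
   [kap] fixed. *)
pose U := upd x i (x i + y i).
have yE : y = upd x i (y i) by rewrite {2}/y /ad upd_same.
have split_U (g : ('I_m -> H) -> H) : multilin g -> g U = g x + g y.
  by move=> gL; rewrite /U (multilinD gL) upd_id -yE.
case: (char2_solve (mxdet E z / r ^+ 2 + a * b) c2 F2 sqF tau0 kap0 sum_c sum_a).
  move=> [j [t e]]; apply: (suff_v (shift false t j U) (t * a' j) (t * c' j)) => //.
  rewrite (split_U (fun u => f (shift false t j u))); last exact: multilin_shift fL.
  rewrite !eval_shift fx fx' fy fy' !mxZ !mxD; congr (mx E); ring.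
move=> [j [k [t [s [jk e]]]]].
apply: (suff_v (shift false s k (shift false t j U)) (t * a' j + s * a' k)
  (t * c' j + s * c' k + t * s * c2 j k)) => //.
rewrite (split_U (fun u => f (shift false s k (shift false t j u)))); last first.
  exact: (@multilin_shift (fun u => f (shift false s k u)) false t j
    (@multilin_shift _ false s k fL)).
rewrite !eval_shift2 // fx !fx' fy !fy' fx'' fy'' scaler0 !mxZ !mxD addr0.
by rewrite !mxD; congr (mx E); ring.
Qed.

End CharacteristicTwo.

(** * Perturbation in quadratically closed and real closed fields *)

Lemma uniq_map_inj_in (T U : eqType) (g : T -> U) (s : seq T) :
  uniq (map g s) -> {in s &, injective g}.
Proof.
elim: s => //= x s IHs /andP[gx us] y z; rewrite !inE.
case/predU1P => [->|ys] /predU1P[->|zs] // e.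
- by case/negP: gx; rewrite e map_f.
- by case/negP: gx; rewrite -e map_f.
- exact: IHs.
Qed.

(** A nonzero polynomial vanishing everywhere would make the field finite; squaring, being
    surjective, would then be injective, although 1 and -1 have the same square. *)
Lemma quadratically_closed_nonroot (F : fieldType) (p : {poly F}) :
  2%:R != 0 :> F -> quadratically_closed F -> p != 0 -> exists t, p.[t] != 0.
Proof.
move=> F2 sqF p0; apply: contrapT => no.
have all_root t : root p t.
  by apply: contrapT => /negP pt; apply: no; exists t.
have size_uniq (s : seq F) : uniq s -> (size s < size p)%N.
  by apply: max_poly_roots => //; apply/allP => t _.
pose P n := `[< exists s : seq F, uniq s /\ size s = n >].
have exP : exists n, P n by exists 0%N; apply/asboolP; exists [::].
have leP n : P n -> (n <= size p)%N.
  by move=> /asboolP[s [us <-]]; apply/ltnW/size_uniq.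
have [_ /asboolP[s [us <-]] smax] := ex_maxnP exP leP.
have s_all t : t \in s.
  apply: contraT => ts; suff : (size s < size s)%N by rewrite ltnn.
  by apply: (smax (size s).+1); apply/asboolP; exists (t :: s); rewrite /= ts.
have us2 : uniq (map (fun t => t ^+ 2) s).
  apply: (leq_size_uniq us) => [t _|]; last by rewrite size_map.
  by have [r <-] := sqF t; apply: map_f.
have : 1 = -1 :> F.
  by apply: (uniq_map_inj_in us2); rewrite ?s_all // expr1n sqrrN expr1n.
by move/eqP; rewrite -addr_eq0 (negbTE F2).
Qed.

Lemma quadratically_closed_perturbation (F : fieldType) :
  2%:R != 0 :> F -> quadratically_closed F -> square_perturbation F.
Proof.
move=> F2 sqF D T T0 [s s0 Ds].
have D0 : D != 0.
  by apply: contraNneq s0 => D0; rewrite -sqrf_eq0 -Ds D0 horner0.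
have [t] := quadratically_closed_nonroot F2 sqF (mulf_neq0 D0 T0).
rewrite hornerM mulf_eq0 ssrbool.negb_or => /andP[Dt Tt]; exists t => //.
have [r rE] := sqF D.[t]; exists r => //.
by apply: contraNneq Dt => r0; rewrite -rE r0 expr0n.
Qed.

Lemma poly_bounded (R : realFieldType) (p : {poly R}) :
  exists2 M, 0 < M & forall t, `|t| <= 1 -> `|p.[t]| <= M.
Proof.
elim/poly_ind: p => [|p c [M M0 pM]].
  by exists 1 => // t _; rewrite horner0 normr0.
exists (M + `|c|) => [|t t1]; first by rewrite ltr_pwDl.
rewrite hornerMXaddC (le_trans (ler_normD _ _)) // lerD2r normrM.
by rewrite -[M]mulr1 ler_pM // pM.
Qed.

Lemma poly_pos_near0 (R : realFieldType) (p : {poly R}) : 0 < p.[0] ->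
  exists2 e, 0 < e & forall t, 0 < t -> t < e -> 0 < p.[t].
Proof.
elim/poly_ind: p => [|p c _]; first by rewrite horner0 ltxx.
rewrite hornerMXaddC mulr0 add0r => c0; have [M M0 pM] := poly_bounded p.
exists (Num.min 1 (c / M)) => [|t t0]; first by rewrite lt_min ltr01 divr_gt0.
rewrite lt_min => /andP[t1 tM]; rewrite hornerMXaddC.
have : - (M * t) <= p.[t] * t.
  rewrite lerNl -mulNr ler_pM2r // (le_trans (ler_norm _)) // normrN pM //.
  by rewrite ger0_norm ltW.
have : M * t < c by rewrite mulrC -ltr_pdivlMr.
lra.
Qed.

(** With [T] written as a power of ['X] times a cofactor [q] nonzero at 0, both [D] and [q * q] stay
    positive for small positive [t]. *)
Lemma real_perturbation (R : rcfType) : square_perturbation R.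
Proof.
move=> D T T0 [s s0 Ds].
have [n [q]] := multiplicity_XsubC T 0; rewrite T0 /= => q0 TE.
have [|e e0 De] := @poly_pos_near0 _ D.
  by rewrite Ds lt_def sqrf_eq0 s0 sqr_ge0.
have [|e' e'0 qe'] := @poly_pos_near0 _ (q * q).
  by rewrite hornerM -expr2 lt_def sqrf_eq0 sqr_ge0 andbT.
pose t := Num.min e e' / 2%:R.
have m0 : 0 < Num.min e e' by rewrite lt_min e0 e'0.
have t0 : 0 < t by rewrite divr_gt0.
have tm : t < Num.min e e' by rewrite /t; lra.
move: tm; rewrite lt_min => /andP[te te']; exists t.
  rewrite TE hornerM mulf_neq0 //.
    by move: (qe' t t0 te'); rewrite hornerM; apply: contraTneq => ->; rewrite mul0r ltxx.
  by rewrite horner_exp hornerXsubC subr0 expf_neq0 // gt_eqF.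
exists (Num.sqrt D.[t]); last by rewrite sqr_sqrtr // ltW // De.
by rewrite gt_eqF // sqrtr_gt0 De.
Qed.

(** * Quaternion algebras *)

Section QuaternionCoordinates.
Variables (F : fieldType) (H : falgType F).
Implicit Types (i j : H) (eps a b : F).

Definition quat i j (x0 x1 x2 x3 : F) : H :=
  x0 *: 1 + x1 *: i + x2 *: j + x3 *: (i * j).

(** One presentation for all characteristics: [eps] is 1 in characteristic 2 and 0 otherwise, and
    [eps%:A - i] is the conjugate of [i]. Spanning alone is recorded, not independence. *)
Definition quat_gen eps a b i j : Prop :=
  [/\ i * i = eps *: i + a%:A, j * i = (eps%:A - i) * j, j * j = b%:A &
      forall x, exists x0 x1 x2 x3, x = quat i j x0 x1 x2 x3].

Lemma quat_lin i j k x0 x1 x2 x3 y0 y1 y2 y3 :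
  k *: quat i j x0 x1 x2 x3 + quat i j y0 y1 y2 y3 =
  quat i j (k * x0 + y0) (k * x1 + y1) (k * x2 + y2) (k * x3 + y3).
Proof.
rewrite /quat !scalerDr !scalerA !scalerDl.
by rewrite addrACA; congr (_ + _); rewrite addrACA; congr (_ + _); rewrite addrACA.
Qed.

Lemma quat0 i j : quat i j 0 0 0 0 = 0.
Proof. by rewrite /quat !scale0r !addr0. Qed.

Lemma quatD i j x0 x1 x2 x3 y0 y1 y2 y3 :
  quat i j x0 x1 x2 x3 + quat i j y0 y1 y2 y3 =
  quat i j (x0 + y0) (x1 + y1) (x2 + y2) (x3 + y3).
Proof. by rewrite -[quat _ _ x0 _ _ _]scale1r quat_lin !mul1r. Qed.

Lemma quatZ i j k x0 x1 x2 x3 :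
  k *: quat i j x0 x1 x2 x3 = quat i j (k * x0) (k * x1) (k * x2) (k * x3).
Proof. by rewrite -[_ *: _]addr0 -(quat0 i j) quat_lin !addr0. Qed.

Lemma quat_basis i j c :
  [/\ c%:A = quat i j c 0 0 0, c *: i = quat i j 0 c 0 0,
      c *: j = quat i j 0 0 c 0 & c *: (i * j) = quat i j 0 0 0 c].
Proof. by rewrite /quat !scale0r ?addr0 ?add0r. Qed.

Lemma quat_mul eps a b i j : quat_gen eps a b i j ->
  forall x0 x1 x2 x3 y0 y1 y2 y3,
  quat i j x0 x1 x2 x3 * quat i j y0 y1 y2 y3 = quat i j
    (x0 * y0 + a * x1 * y1 + b * (x2 * (y2 + eps * y3) - a * x3 * y3))
    (x0 * y1 + x1 * y0 + eps * x1 * y1 + b * (x3 * y2 - x2 * y3))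
    (x0 * y2 + a * x1 * y3 + x2 * (y0 + eps * y1) - a * x3 * y1)
    (x0 * y3 + x1 * y2 + eps * x1 * y3 + x3 * y0 - x2 * y1).
Proof.
move=> [ii ji jj _] x0 x1 x2 x3 y0 y1 y2 y3.
have basis c := quat_basis i j c.
have iM z0 z1 z2 z3 : i * quat i j z0 z1 z2 z3 =
    quat i j (a * z1) (z0 + eps * z1) (a * z3) (z2 + eps * z3).
  rewrite {1}/quat !mulrDr -!scalerAr mulr1 mulrA ii mulrDl -!scalerAl mul1r.
  rewrite !scalerDr !scalerA.
  have [-> _ _ _] := basis (z1 * a); have [_ -> _ _] := basis z0.
  have [_ -> _ _] := basis (z1 * eps); have [_ _ _ ->] := basis z2.
  have [_ _ _ ->] := basis (z3 * eps); have [_ _ -> _] := basis (z3 * a).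
  by rewrite !quatD; congr quat; ring.
have jM z0 z1 z2 z3 : j * quat i j z0 z1 z2 z3 =
    quat i j (b * z2 + eps * b * z3) (- (b * z3)) (z0 + eps * z1) (- z1).
  rewrite {1}/quat !mulrDr -!scalerAr mulr1 mulrA ji jj !mulrBl !mulr_algl.
  rewrite -scalerAl -[i * j * j]mulrA jj mulr_algr !scalerBr !scalerA.
  have [_ _ -> _] := basis z0; have [_ _ -> _] := basis (z1 * eps).
  have [_ _ _ ->] := basis z1; have [-> _ _ _] := basis (z2 * b).
  have [-> _ _ _] := basis (z3 * eps * b); have [_ -> _ _] := basis (z3 * b).
  by rewrite -!scaleN1r !quatZ !quatD; congr quat; ring.
rewrite {1}/quat !mulrDl -!scalerAl mul1r -[i * j * _]mulrA jM !iM !quatZ !quatD.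
by congr quat; ring.
Qed.

(** The norm of p + q i from F[i]. *)
Definition knorm eps a (p q : F) : F := p ^+ 2 + eps * p * q - a * q ^+ 2.

Lemma quat_norm eps a b i j x0 x1 x2 x3 : quat_gen eps a b i j ->
  let N := knorm eps a x0 x1 - b * knorm eps a x2 x3 in
  let x := quat i j x0 x1 x2 x3 in
  let x' := quat i j (x0 + eps * x1) (- x1) (- x2) (- x3) in
  x * x' = N%:A /\ x' * x = N%:A.
Proof.
move=> g N x x'; rewrite /x /x' !(quat_mul g).
have [-> _ _ _] := quat_basis i j N.
by rewrite /N /knorm; split; congr quat; ring.
Qed.

(* The norm form of F[i] is multiplicative, hence represents b when b is a
   quotient of two nonzero norms; and it is universal when it is isotropic. *)
Lemma knorm_represents eps a b x0 x1 x2 x3 : eps ^+ 2 + 4%:R * a != 0 ->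
  knorm eps a x0 x1 = b * knorm eps a x2 x3 ->
  [|| x0 != 0, x1 != 0, x2 != 0 | x3 != 0] ->
  exists p q, b = knorm eps a p q.
Proof.
move=> disc0 Nx xn0.
have isotropic p q : knorm eps a p q = 0 -> (p != 0) || (q != 0) ->
    exists p q, b = knorm eps a p q.
  (* Along the isotropic direction [(p, q)] the norm is affine in [t]. Starting at 1 or at [i], it
     takes every value unless the slope vanishes; both slopes vanish only for [p = q = 0]. *)
  move=> N0 pq0; have [B0|B0] := eqVneq (2%:R * p + eps * q) 0; last first.
    pose t := (b - 1) / (2%:R * p + eps * q).
    exists (1 + t * p), (t * q).
    transitivity (1 + t * (2%:R * p + eps * q) + t ^+ 2 * knorm eps a p q).
      by rewrite N0 mulr0 addr0 /t divfK // addrC subrK.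
    by rewrite /knorm; ring.
  have [C0|C0] := eqVneq (eps * p - 2%:R * a * q) 0; last first.
    pose t := (b + a) / (eps * p - 2%:R * a * q).
    exists (t * p), (1 + t * q).
    transitivity (- a + t * (eps * p - 2%:R * a * q) + t ^+ 2 * knorm eps a p q).
      by rewrite N0 mulr0 addr0 /t divfK // addrC addrK.
    by rewrite /knorm; ring.
  have p0 : p == 0.
    have : (eps ^+ 2 + 4%:R * a) * p == 0.
      apply/eqP; transitivity (eps * (eps * p - 2%:R * a * q)
        + 2%:R * a * (2%:R * p + eps * q)); first by ring.
      by rewrite B0 C0 !mulr0 addr0.
    by rewrite mulf_eq0 (negbTE disc0).
  have q0 : q == 0.
    have : (eps ^+ 2 + 4%:R * a) * q == 0.
      apply/eqP; transitivity (eps * (2%:R * p + eps * q)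
        - 2%:R * (eps * p - 2%:R * a * q)); first by ring.
      by rewrite B0 C0 !mulr0 subr0.
    by rewrite mulf_eq0 (negbTE disc0).
  by move: pq0; rewrite p0 q0.
have [N0|N0] := eqVneq (knorm eps a x2 x3) 0; last first.
  (* The coordinates of the quotient of x0 + x1 i by x2 + x3 i. *)
  exists ((x0 * (x2 + eps * x3) - a * x1 * - x3) / knorm eps a x2 x3 
    + 2%:R * (a * x1 * - x3) / knorm eps a x2 x3),
    ((x1 * x2 - x0 * x3) / knorm eps a x2 x3).
  apply: (mulIf N0); rewrite -Nx; move: N0; rewrite /knorm => N0; field.
  by [].
have [/isotropic|] := boolP ((x2 != 0) || (x3 != 0)); first exact.
rewrite ssrbool.negb_or !negbK => /andP[/eqP x20 /eqP x30].
move: xn0; rewrite x20 x30 eqxx !orbF; apply: isotropic.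
by rewrite Nx N0 mulr0.
Qed.

(** For z = p + q i of norm [b], the element s = z^-1 j has square 1 and still conjugates [i]. *)
Lemma quat_split eps a b i j : quat_gen eps a b i j -> b != 0 ->
  (exists p q, b = knorm eps a p q) -> exists s, quat_gen eps a 1 i s.
Proof.
move=> g b0 [p [q bE]]; have mulE := quat_mul g; have [ii ji jj span] := g.
have iE' : i = quat i j 0 1 0 0 by have [_ <- _ _] := quat_basis i j 1; rewrite scale1r.
pose s := quat i j 0 0 ((p + eps * q) / b) (- q / b).
have qs y0 y1 y2 y3 : quat i s y0 y1 y2 y3 =
    quat i j y0 y1 0 0 + quat i j y2 y3 0 0 * s.
  by rewrite /quat !scale0r !addr0 mulrDl -!scalerAl mul1r addrA.
exists s; split=> //.
- have -> : s * i = s * quat i j 0 1 0 0 by rewrite -iE'.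
  have -> : eps%:A - i = quat i j eps (-1) 0 0.
    by rewrite /quat scaleN1r !scale0r !addr0.
  by rewrite /s !mulE; congr quat; field.
- rewrite /s mulE; have [-> _ _ _] := quat_basis i j 1.
  have e : (p + eps * q) * p - a * q ^+ 2 = b by rewrite bE /knorm; ring.
  congr quat; last 3 first; try by ring.
  transitivity ((p + eps * q) * p / b - a * q ^+ 2 / b); first by field.
  by rewrite -mulrBl e divff.
- move=> x; have [x0 [x1 [x2 [x3 ->]]]] := span x.
  exists x0, x1, (x2 * p + a * x3 * q), (x2 * q + x3 * p + eps * x3 * q).
  rewrite qs /s mulE quatD.
  have e : p ^+ 2 + eps * p * q - a * q ^+ 2 = b by rewrite bE.
  congr quat; try by ring.
    transitivity (x2 * (p ^+ 2 + eps * p * q - a * q ^+ 2) / b); last by field.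
    by rewrite e mulfK.
  transitivity (x3 * (p ^+ 2 + eps * p * q - a * q ^+ 2) / b); last by field.
  by rewrite e mulfK.
Qed.

(** The algebra acts on F[i] with basis 1, i: [i] by multiplication, [s] by conjugation. [E] inverts
    this representation, and its denominator [d] is the discriminant of F[i]. *)
Lemma quat_matrix eps a i s : quat_gen eps a 1 i s ->
  eps ^+ 2 + 4%:R * a != 0 -> inhabited (matrix_coords H).
Proof.
move=> g d0; have mulE := quat_mul g; have [_ _ _ span] := g.
pose d := eps ^+ 2 + 4%:R * a.
pose E A B C D := quat i s
  (A * (1 - 2%:R * a / d) - B * eps / d - C * a * eps / d + D * 2%:R * a / d)
  (- A * eps / d + 2%:R * B / d + C * (1 - 2%:R * a / d - eps ^+ 2 / d)
     + D * eps / d)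
  (A * 2%:R * a / d + B * eps / d + C * a * eps / d - D * 2%:R * a / d)
  (A * eps / d - 2%:R * B / d + C * (2%:R * a / d + eps ^+ 2 / d) - D * eps / d).
have Elin k A B C D A' B' C' D' : k *: E A B C D + E A' B' C' D' =
    E (k * A + A') (k * B + B') (k * C + C') (k * D + D').
  by rewrite /E quat_lin; congr quat; ring.
have Emul A B C D A' B' C' D' : E A B C D * E A' B' C' D' =
    E (A * A' + B * C') (A * B' + B * D') (C * A' + D * C') (C * B' + D * D').
  by rewrite /E mulE /d; congr quat; field.
have E1 : E 1 0 0 1 = 1.
  have [e _ _ _] := quat_basis i s 1; rewrite scale1r in e; rewrite [RHS]e /E /d.
  by congr quat; field.
have Esurj x : exists t : F * F * F * F, E t.1.1.1 t.1.1.2 t.1.2 t.2 = x.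
  have [x0 [x1 [x2 [x3 ->]]]] := span x.
  exists (x0 + x2, a * x1 + eps * x2 - a * x3, x1 + x3, x0 + eps * x1 - x2).
  by rewrite /E /d /=; congr quat; field.
have E0 : E 0 0 0 0 = 0.
  by have := Elin (-1) 1 1 1 1 1 1 1 1; rewrite scaleN1r mulr1 !addNr.
(* Simplicity of the matrix algebra: if e11 were 0, then so would be 1. *)
have Ecorner t : E t 0 0 0 = 0 -> t = 0.
  move=> e; apply/eqP; apply: contraT => t0.
  have e11 : E 1 0 0 0 = 0.
    have := Elin t^-1 t 0 0 0 0 0 0 0.
    by rewrite e E0 scaler0 addr0 mulVf // !mulr0 !addr0 => <-.
  have : E 1 0 0 1 = 0.
    have := Elin 1 1 0 0 0 0 0 0 1; rewrite scale1r e11 add0r.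
    rewrite !mulr0 mulr1 !addr0 add0r => <-.
    have := Emul 0 0 1 0 0 1 0 0; rewrite ?(mul0r, mulr0, mulr1, add0r, addr0) => <-.
    have := Emul 0 0 1 0 1 0 0 0; rewrite ?(mul0r, mulr0, mulr1, add0r, addr0) => <-.
    by rewrite e11 mulr0 mul0r.
  by rewrite E1 => /eqP; rewrite oner_eq0.
have Einj A B C D : E A B C D = 0 -> [/\ A = 0, B = 0, C = 0 & D = 0].
  move=> e; split; apply: Ecorner.
  - have := congr1 (fun x => E 1 0 0 0 * x * E 1 0 0 0) e; rewrite mulr0 mul0r => <-.
    by rewrite !Emul; congr E; ring.
  - have := congr1 (fun x => E 1 0 0 0 * x * E 0 0 1 0) e; rewrite mulr0 mul0r => <-.
    by rewrite !Emul; congr E; ring.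
  - have := congr1 (fun x => E 0 1 0 0 * x * E 1 0 0 0) e; rewrite mulr0 mul0r => <-.
    by rewrite !Emul; congr E; ring.
  - have := congr1 (fun x => E 0 1 0 0 * x * E 0 0 1 0) e; rewrite mulr0 mul0r => <-.
    by rewrite !Emul; congr E; ring.
have [t tE] := choice Esurj.
have tK A B C D : t (E A B C D) = (A, B, C, D).
  have e := tE (E A B C D).
  have := Elin (-1) A B C D (t (E A B C D)).1.1.1 (t (E A B C D)).1.1.2
    (t (E A B C D)).1.2 (t (E A B C D)).2.
  rewrite e scaleN1r addNr => /esym/Einj[].
  case: (t _) => [[[A' B'] C'] D'] /=; rewrite !mulN1r.
  by move=> /eqP + /eqP + /eqP + /eqP; rewrite ![- _ + _]addrC !subr_eq0
    => /eqP-> /eqP-> /eqP-> /eqP->.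
constructor.
exact: (@MatrixCoords _ _ E (fun x => (t x).1.1.1) (fun x => (t x).1.1.2)
  (fun x => (t x).1.2) (fun x => (t x).2) tE
  (fun A B C D => congr1 (fun u => u.1.1.1) (tK A B C D))
  (fun A B C D => congr1 (fun u => u.1.1.2) (tK A B C D))
  (fun A B C D => congr1 (fun u => u.1.2) (tK A B C D))
  (fun A B C D => congr1 snd (tK A B C D)) Elin Emul E1).
Qed.

Lemma quaternion_generators : is_quaternion_algebra H ->
  exists eps a b i j, [/\ quat_gen eps a b i j, b != 0,
    eps ^+ 2 + 4%:R * a != 0 & 2%:R != 0 :> F -> eps = 0].
Proof.
move=> [i [j [/andP[/eqP spanE _] rel]]].
have span x : exists x0 x1 x2 x3, x = quat i j x0 x1 x2 x3.
  have : x \in span [:: 1; i; j; i * j] by rewrite spanE memvf.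
  rewrite !span_cons span_nil addv0.
  move=> /memv_addP[_ /vlineP[x0 ->] [_ /memv_addP[_ /vlineP[x1 ->]
    [_ /memv_addP[_ /vlineP[x2 ->] [_ /vlineP[x3 ->] ->]] ->]] ->]].
  by exists x0, x1, x2, x3; rewrite /quat !addrA.
have four : 4%:R = 2%:R * 2%:R :> F by rewrite -natrM.
move: rel; rewrite /quaternion_relations; case: ifP => [|].
  rewrite inE => /andP[_ /eqP F2] [[b b0 jj] [a ii] ij].
  have double (x : H) : x + x = 0.
    by rewrite -mulr2n -scaler_nat F2 scale0r.
  have opp (x : H) : - x = x by apply/eqP; rewrite eq_sym -addr_eq0 double.
  exists 1, a, b, i, j; split=> //.
  - split=> //.
    + by rewrite scale1r -ii expr2 addrCA double addr0.
    + by rewrite mulrBl ij scale1r mul1r mulrDr mulr1 opprD addrCA subrr addr0 opp.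
  - by rewrite four F2 !mul0r addr0 expr1n oner_eq0.
  - by rewrite F2 eqxx.
rewrite inE /= => F2 [[a a0 ii] [b b0 jj] ij].
exists 0, a, b, i, j; split=> //.
- split=> //; first by rewrite scale0r add0r.
  by rewrite scale0r sub0r mulNr ij opprK.
- by rewrite expr0n add0r four !mulf_neq0 ?F2.
Qed.

(** If [b] were not a norm from F[i], every nonzero element would have nonzero norm and hence an
    inverse. *)
Lemma split_quaternion : is_quaternion_algebra H -> ~ is_division_ring H ->
  inhabited (matrix_coords H).
Proof.
move=> /quaternion_generators[eps [a [b [i [j [g b0 d0 _]]]]]] ndiv.
suff [s gs] : exists s, quat_gen eps a 1 i s by apply: quat_matrix gs d0.
apply: (quat_split g b0); apply: contrapT => no; apply: ndiv => x x0.
have [_ _ _ span] := g; have [x1 [x2 [x3 [x4 xE]]]] := span x.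
pose N := knorm eps a x1 x2 - b * knorm eps a x3 x4.
have [xx' x'x] := quat_norm x1 x2 x3 x4 g; rewrite -/N -xE in xx' x'x.
have N0 : N != 0.
  apply/eqP => /subr0_eq Nx; apply: no; apply: (knorm_represents d0 Nx).
  apply: contraNT x0; rewrite !ssrbool.negb_or !negbK.
  by move=> /and4P[/eqP y1 /eqP y2 /eqP y3 /eqP y4]; rewrite xE y1 y2 y3 y4 quat0.
apply/unitrP; exists (N^-1 *: quat i j (x1 + eps * x2) (- x2) (- x3) (- x4)).
by split; [rewrite -scalerAl x'x|rewrite -scalerAr xx']; rewrite scalerA mulVf // scale1r.
Qed.

End QuaternionCoordinates.

(** * Hamilton quaternions *)

Section HamiltonQuaternions.
Variables (R : rcfType) (H : falgType R) (a b : R) (i j : H).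
Hypothesis gen : quat_gen 0 a b i j.
Hypotheses (a_lt0 : a < 0) (b_lt0 : b < 0).
Variables (m : nat) (lam : 'S_m -> R).
Local Notation Q := (quat i j).
Local Notation f := (mleval (A := H) lam).
Local Notation fL := (mleval_multilin (A := H) lam).

(** The norm form, positive definite for negative [a] and [b]; the generators are not normalized to
    have square -1. *)
Definition hnorm (x0 x1 x2 x3 : R) : R :=
  x0 ^+ 2 - a * x1 ^+ 2 - b * x2 ^+ 2 + a * b * x3 ^+ 2.

Lemma hnorm_sum x0 x1 x2 x3 : [/\ 0 <= - a * x1 ^+ 2, 0 <= - b * x2 ^+ 2,
  0 <= a * b * x3 ^+ 2 & hnorm x0 x1 x2 x3 =
    x0 ^+ 2 + (- a * x1 ^+ 2 + (- b * x2 ^+ 2 + a * b * x3 ^+ 2))].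
Proof.
split; last by rewrite /hnorm; ring.
- by rewrite mulr_ge0 ?sqr_ge0 // oppr_ge0 ltW.
- by rewrite mulr_ge0 ?sqr_ge0 // oppr_ge0 ltW.
- by rewrite mulr_ge0 ?sqr_ge0 // nmulr_rge0 // ltW.
Qed.

Lemma hnorm_eq0 x0 x1 x2 x3 : hnorm x0 x1 x2 x3 <= 0 ->
  [/\ x0 = 0, x1 = 0, x2 = 0 & x3 = 0].
Proof.
have [h1 h2 h3 ->] := hnorm_sum x0 x1 x2 x3; have h0 := sqr_ge0 x0 => le0.
have ab0 : a * b != 0 by rewrite mulf_neq0 // lt_eqF.
have z0 : x0 ^+ 2 = 0 by lra.
have z1 : - a * x1 ^+ 2 = 0 by lra.
have z2 : - b * x2 ^+ 2 = 0 by lra.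
have z3 : a * b * x3 ^+ 2 = 0 by lra.
split; apply/eqP.
- by rewrite -sqrf_eq0 z0.
- by move/eqP: z1; rewrite mulf_eq0 oppr_eq0 (lt_eqF a_lt0) sqrf_eq0.
- by move/eqP: z2; rewrite mulf_eq0 oppr_eq0 (lt_eqF b_lt0) sqrf_eq0.
- by move/eqP: z3; rewrite mulf_eq0 (negbTE ab0) sqrf_eq0.
Qed.

Lemma quat_conj_mul x0 x1 x2 x3 :
  Q x0 x1 x2 x3 * Q x0 (- x1) (- x2) (- x3) = (hnorm x0 x1 x2 x3)%:A /\
  Q x0 (- x1) (- x2) (- x3) * Q x0 x1 x2 x3 = (hnorm x0 x1 x2 x3)%:A.
Proof.
have := quat_norm x0 x1 x2 x3 gen; rewrite /= mul0r addr0 => -[-> ->].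
by rewrite /knorm /hnorm; split; congr (_ *: _); ring.
Qed.

Lemma hquat_eq0 x0 x1 x2 x3 : Q x0 x1 x2 x3 = 0 ->
  [/\ x0 = 0, x1 = 0, x2 = 0 & x3 = 0].
Proof.
move=> e; have [] := quat_conj_mul x0 x1 x2 x3; rewrite e mul0r => N0 _.
apply: hnorm_eq0; suff -> : hnorm x0 x1 x2 x3 = 0 by [].
by move/eqP: N0; rewrite eq_sym scaler_eq0 oner_eq0 orbF => /eqP.
Qed.

Lemma hquat_inj x0 x1 x2 x3 y0 y1 y2 y3 : Q x0 x1 x2 x3 = Q y0 y1 y2 y3 ->
  [/\ x0 = y0, x1 = y1, x2 = y2 & x3 = y3].
Proof.
move=> e; have := quat_lin i j (-1) x0 x1 x2 x3 y0 y1 y2 y3.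
rewrite e scaleN1r addNr => /esym/hquat_eq0[] e0 e1 e2 e3.
by split; apply/eqP; rewrite eq_sym -subr_eq0 addrC -mulN1r; apply/eqP.
Qed.

Lemma hquat_inverse (x : H) : x != 0 -> exists x', x * x' = 1 /\ x' * x = 1.
Proof.
have [_ _ _ span] := gen; have [x0 [x1 [x2 [x3 ->]]]] := span x => xn0.
have N0 : hnorm x0 x1 x2 x3 != 0.
  apply: contraNneq xn0 => N0.
  have [|-> -> -> ->] := @hnorm_eq0 x0 x1 x2 x3; first by rewrite N0.
  by rewrite quat0.
have [e e'] := quat_conj_mul x0 x1 x2 x3.
exists ((hnorm x0 x1 x2 x3)^-1 *: Q x0 (- x1) (- x2) (- x3)).
by rewrite -scalerAr -scalerAl e e' scalerA mulVf // scale1r.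
Qed.

(* If x and y have equal traces and norms then z = yw - wx', with x' the
   conjugate of x, satisfies zx = yz for every w. *)
Lemma hquat_conjugate x0 x1 x2 x3 y1 y2 y3 (I : H -> Prop) : conj_closed I ->
  hnorm x0 x1 x2 x3 = hnorm x0 y1 y2 y3 -> x0 ^+ 2 < hnorm x0 x1 x2 x3 ->
  I (Q x0 x1 x2 x3) -> I (Q x0 y1 y2 y3).
Proof.
move=> Ic eN ns Ix; have [_ x'x] := quat_conj_mul x0 x1 x2 x3.
set x := Q x0 x1 x2 x3 in Ix x'x; set y := Q x0 y1 y2 y3.
set x' := Q _ _ _ _ in x'x.
have xx' : x + x' = (2%:R * x0)%:A.
  have [-> _ _ _] := quat_basis i j (2%:R * x0).
  by rewrite /x /x' quatD; congr quat; ring.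
have yy : y * y = (2%:R * x0) *: y - (hnorm x0 x1 x2 x3)%:A.
  have [-> _ _ _] := quat_basis i j (hnorm x0 x1 x2 x3).
  rewrite /y (quat_mul gen) eN -scaleN1r quatZ [X in _ = _ + X]quatZ quatD /hnorm.
  by congr quat; ring.
have comm w : (y * w - w * x') * x = y * (y * w - w * x').
  rewrite mulrBl mulrBr !mulrA yy -[w * x' * x]mulrA x'x.
  have -> : y * w * x' = y * w * ((2%:R * x0)%:A - x) by rewrite -xx' addrAC subrr add0r.
  rewrite mulrBr mulrBl !mulr_algr !mulr_algl -scalerAl opprB.
  by rewrite [RHS]addrC addrA subrK.
have done_with w : y * w - w * x' != 0 -> I y.
  move=> z0; have [z' [zz' z'z]] := hquat_inverse z0.
  have -> : y = (y * w - w * x') * x * z' by rewrite comm -mulrA zz' mulr1.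
  exact: Ic.
(* If [w = 1] fails, [y] is the conjugate of [x]. Then [w = i] or [w = j] works, since [x] is not
   real by the strict inequality. *)
have [yx'|yx'] := eqVneq (y - x') 0; last first.
  by apply: (done_with 1); rewrite mulr1 mul1r.
have {yx'} yE : y = x' by apply: subr0_eq.
have [/andP[/eqP x20 /eqP x30]|x23] := boolP ((x2 == 0) && (x3 == 0)); last first.
  apply: (done_with (Q 0 1 0 0)); apply: contraNneq x23.
  rewrite yE /x' !(quat_mul gen) -scaleN1r quatZ quatD => /hquat_eq0[_ _ e2 e3].
  apply/andP; split; apply/eqP; first by move: e3; lra.
  have a0 : a != 0 by rewrite lt_eqF.
  by apply: (mulfI a0); rewrite mulr0; move: e2; lra.
apply: (done_with (Q 0 0 1 0)); apply: contraTneq ns.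
rewrite yE /x' !(quat_mul gen) -scaleN1r quatZ quatD => /hquat_eq0[_ _ _ e3].
have x10 : x1 = 0 by move: e3; lra.
by rewrite /hnorm x10 x20 x30 expr0n /= !mulr0 !subr0 addr0 ltxx.
Qed.

Definition basis_quat (x : H) : Prop :=
  [\/ x = Q 1 0 0 0, x = Q 0 1 0 0, x = Q 0 0 1 0 | x = Q 0 0 0 1].

Lemma basis_quat_spanning : spanning basis_quat.
Proof.
move=> S SB Slin x.
have [_ _ _ span] := gen; have [x0 [x1 [x2 [x3 ->]]]] := span x.
have -> : Q x0 x1 x2 x3 = x0 *: Q 1 0 0 0 + (x1 *: Q 0 1 0 0 +
    (x2 *: Q 0 0 1 0 + (x3 *: Q 0 0 0 1 + (-1 *: Q 0 0 0 1 + Q 0 0 0 1)))).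
  by rewrite !quatZ !quatD; congr quat; ring.
have [u1 u2 u3 u4] : [/\ basis_quat (Q 1 0 0 0), basis_quat (Q 0 1 0 0),
    basis_quat (Q 0 0 1 0) & basis_quat (Q 0 0 0 1)].
  by split; [apply: Or41|apply: Or42|apply: Or43|apply: Or44].
by do !(apply: (Slin); first exact: SB); apply: SB.
Qed.

(** The components of the grading by the Klein four-group; [grade_i] and [grade_j] below are its
    coarsenings by the degrees in [i] and in [j] modulo 2. *)
Definition grade (s : bool * bool) (p : R) : H :=
  match s with
  | (false, false) => Q p 0 0 0
  | (true, false) => Q 0 p 0 0
  | (false, true) => Q 0 0 p 0
  | (true, true) => Q 0 0 0 p
  end.

Definition grade_i (s : bool) (x : H) : Prop :=
  exists p q, x = if s then Q 0 p 0 q else Q p 0 q 0.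

Definition grade_j (s : bool) (x : H) : Prop :=
  exists p q, x = if s then Q 0 0 p q else Q p q 0 0.

Lemma grade_i_eval t u : (forall k, grade_i (t k) (u k)) ->
  grade_i (\big[addb/false]_k t k) (f u).
Proof.
apply: mleval_graded.
- by move=> s; exists 0, 0; rewrite quat0; case: s.
- move=> s k x y [p [q ->]] [p' [q' ->]].
  exists (k * p + p'), (k * q + q').
  by case: s; rewrite quat_lin; congr quat; ring.
- by exists 1, 0; rewrite /quat !scale0r scale1r !addr0.
move=> s s' x y [p [q ->]] [p' [q' ->]]; rewrite /grade_i.
by case: s s' => [] []; rewrite (quat_mul gen);
   rewrite ?(mul0r, mulr0, addr0, add0r, subr0, oppr0); eexists _, _.
Qed.

Lemma grade_j_eval t u : (forall k, grade_j (t k) (u k)) ->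
  grade_j (\big[addb/false]_k t k) (f u).
Proof.
apply: mleval_graded.
- by move=> s; exists 0, 0; rewrite quat0; case: s.
- move=> s k x y [p [q ->]] [p' [q' ->]].
  exists (k * p + p'), (k * q + q').
  by case: s; rewrite quat_lin; congr quat; ring.
- by exists 1, 0; rewrite /quat !scale0r scale1r !addr0.
move=> s s' x y [p [q ->]] [p' [q' ->]]; rewrite /grade_j.
by case: s s' => [] []; rewrite (quat_mul gen);
   rewrite ?(mul0r, mulr0, addr0, add0r, subr0, oppr0); eexists _, _.
Qed.

Lemma basis_quat_value (P : H -> Prop) : lin_closed P ->
  ~ (forall u, P (f u)) -> exists u s p, f u = grade s p /\ ~ P (grade s p).
Proof.
move=> Plin nP; apply: contrapT => no; apply: nP.
apply: (multilin_ind fL basis_quat_spanning Plin) => u uB.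
apply: contrapT => nPu; apply: no.
have [t ut] : exists t : 'I_m -> bool, forall k, grade_i (t k) (u k).
  apply: (@fin_all_exists _ _ (fun k s => grade_i s (u k))) => k.
  by case: (uB k) => ->; [exists false, 1, 0|exists true, 1, 0|exists false, 0, 1|
    exists true, 0, 1].
have [t' ut'] : exists t : 'I_m -> bool, forall k, grade_j (t k) (u k).
  apply: (@fin_all_exists _ _ (fun k s => grade_j s (u k))) => k.
  by case: (uB k) => ->; [exists false, 1, 0|exists false, 0, 1|exists true, 1, 0|
    exists true, 0, 1].
have [p [q fE]] := grade_i_eval ut; have [p' [q' fE']] := grade_j_eval ut'.
suff [s [c fc]] : exists s c, f u = grade s c.
  by exists u, s, c; rewrite -fc.
move: fE'; rewrite fE.
by case: ifP => _; case: ifP => _ /hquat_inj[? ? ? ?]; subst;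
  [exists (true, true)|exists (true, false)|exists (false, true)|
   exists (false, false)]; eexists.
Qed.

(** Pure quaternions of equal norm are conjugate, and real scaling reaches every positive norm. *)
Lemma hquat_pure_sub (I : H -> Prop) v1 v2 v3 : conj_closed I ->
  (forall (r : R) x, I x -> I (r *: x)) -> I (Q 0 v1 v2 v3) ->
  Q 0 v1 v2 v3 != 0 -> forall x1 x2 x3, I (Q 0 x1 x2 x3).
Proof.
move=> Ic Iscale Iv v0 x1 x2 x3.
have scale r : I (Q 0 (r * v1) (r * v2) (r * v3)).
  by rewrite -{1}(mulr0 r) -quatZ; apply: Iscale.
have N0 : 0 < hnorm 0 v1 v2 v3.
  rewrite ltNge; apply: contra v0 => /hnorm_eq0[_ -> -> ->].
  by rewrite quat0.
have [le0|x0] := leP (hnorm 0 x1 x2 x3) 0.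
  by have [_ -> -> ->] := hnorm_eq0 le0; have := scale 0; rewrite !mul0r.
pose r := Num.sqrt (hnorm 0 x1 x2 x3 / hnorm 0 v1 v2 v3).
have rE : r ^+ 2 * hnorm 0 v1 v2 v3 = hnorm 0 x1 x2 x3.
  by rewrite sqr_sqrtr ?divfK ?divr_ge0 ?gt_eqF // ltW.
have e : hnorm 0 (r * v1) (r * v2) (r * v3) = hnorm 0 x1 x2 x3.
  by rewrite -rE /hnorm; ring.
by apply: (hquat_conjugate Ic e _ (scale r)); rewrite e expr0n.
Qed.

Lemma hquat_scalar_or_pure : (exists l : 'I_m, True) ->
  (forall u, exists k : R, f u = k%:A) \/
  (forall x1 x2 x3, mlimage lam (Q 0 x1 x2 x3)).
Proof.
move=> m0; have [?|nsc] := pselect (forall u, exists k : R, f u = k%:A).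
  by left.
right.
have [|u [s [p [fu nP]]]] := @basis_quat_value (fun x => exists k : R, x = k%:A) _ nsc.
  by move=> k x y [c ->] [c' ->]; exists (k * c + c'); rewrite scalerA -scalerDl.
have [v1 [v2 [v3 fv]]] : exists v1 v2 v3, f u = Q 0 v1 v2 v3.
  move: s fu nP => [[] []] /=; try by eauto.
  by move=> _ []; exists p; have [-> _ _ _] := quat_basis i j p.
apply: (hquat_pure_sub (v1 := v1) (v2 := v2) (v3 := v3)).
- exact: mlimage_conj.
- by move=> r x; apply: mlimage_scale.
- by exists u.
- by apply: contra_notN nP => /eqP e; rewrite -fu fv e; exists 0; rewrite scale0r.
Qed.

Definition re_zero (x : H) : Prop := exists x1 x2 x3, x = Q 0 x1 x2 x3.

(* The sign of q(x) = re(x)^2 - k |x|^2 cannot change along a pencil of values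
   without q vanishing at a nonzero value. *)
Lemma hquat_full : (exists l : 'I_m, True) ->
  ~ (forall u, exists k : R, f u = k%:A) -> ~ (forall u, re_zero (f u)) ->
  forall x : H, mlimage lam x.
Proof.
move=> m0 nsc nre x.
have pure : forall x1 x2 x3, mlimage lam (Q 0 x1 x2 x3).
  by have [|] := hquat_scalar_or_pure m0.
have [|v [s [c [fv nP]]]] := @basis_quat_value re_zero _ nre.
  move=> k y z [y1 [y2 [y3 ->]]] [z1 [z2 [z3 ->]]]; rewrite quat_lin mulr0 addr0.
  by eexists _, _, _.
have {s nP fv}[fv c0] : f v = Q c 0 0 0 /\ c != 0.
  move: s fv nP => [[] []] /= fv nP; try by case: nP; eexists _, _, _.
  by split=> //; apply: contra_notN nP => /eqP->; exists 0, 0, 0.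
have [_ _ _ span] := gen; have [x0 [x1 [x2 [x3 ->]]]] := span x.
have [->|x00] := eqVneq x0 0; first exact: pure.
have [le_x|ns] := leP (hnorm x0 x1 x2 x3) (x0 ^+ 2).
  have [_ -> -> ->] : [/\ 0 = 0 :> R, x1 = 0, x2 = 0 & x3 = 0].
    by apply: hnorm_eq0; move: le_x; rewrite /hnorm expr0n /=; lra.
  have [l _] := m0; exists (upd v l ((x0 / c) *: v l)).
  by rewrite (multilinZ fL) upd_id fv quatZ divfK // mulr0.
have x0_gt0 : 0 < x0 ^+ 2 by rewrite lt_def sqrf_eq0 x00 sqr_ge0.
have N0 : 0 < hnorm x0 x1 x2 x3 by apply: lt_trans ns.
(* With this [k], the zeros of q with nonzero real part are, up to scaling and conjugation, the
   target. *)
pose k := x0 ^+ 2 / hnorm x0 x1 x2 x3.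
have k0 : 0 < k by rewrite divr_gt0.
have k1 : k < 1 by rewrite ltr_pdivrMr // mul1r.
have coords y : exists z : R * R * R * R, Q z.1.1.1 z.1.1.2 z.1.2 z.2 = y.
  by have [y0 [y1 [y2 [y3 ->]]]] := span y; exists (y0, y1, y2, y3).
have [t tE] := choice coords.
have tK y0 y1 y2 y3 : t (Q y0 y1 y2 y3) = (y0, y1, y2, y3).
  have := tE (Q y0 y1 y2 y3).
  by case: (t _) => [[[z0 z1] z2] z3] /= /hquat_inj[-> -> -> ->].
pose q0 (y : R * R * R * R) := y.1.1.1 ^+ 2 - k * hnorm y.1.1.1 y.1.1.2 y.1.2 y.2.
pose q y := q0 (t y).
have [w [fw0 qw]] : exists w, f w != 0 /\ q (f w) = 0.
  apply: contrapT => no.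
  have nonzero w : f w != 0 -> q (f w) != 0.
    by move=> fw0; apply/eqP => qw; apply: no; exists w.
  (* A value on which q is [k * a < 0], whereas q is positive on the real value [f v]. *)
  have [w fw] := pure 1 0 0.
  have Rvw : 0 < q (f v) -> 0 < q (f w).
    apply: (multilin_connect fL (V := fun _ _ => True)
      (R := fun y z => 0 < q y -> 0 < q z)) => //.
    - by move=> y1 y2 y3 h1 h2 /h1/h2.
    - move=> u l y _ _ fu fy qu; rewrite ltNge; apply/negP => qy.
      have {}qy : q (f (upd u l y)) < 0 by rewrite lt_neqAle nonzero.
      have [y0 [y1 [y2 [y3 yE]]]] := span (f (upd u l y)).
      have [u0 [u1 [u2 [u3 uE]]]] := span (f u).
      pose be := 2%:R * (u0 * y0 - k * (u0 * y0 - a * u1 * y1 - b * u2 * y2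
        + a * b * u3 * y3)).
      have qE r : q (f u + r *: f (upd u l y)) =
          q (f u) + r * be + r ^+ 2 * q (f (upd u l y)).
        rewrite uE yE quatZ quatD /q !tK /q0 /be /hnorm /=; ring.
      pose D := be ^+ 2 - 4%:R * q (f u) * q (f (upd u l y)).
      have D0 : 0 <= D.
        rewrite /D subr_ge0 (le_trans _ (sqr_ge0 _)) // -mulrA mulr_ge0_le0 //.
        by rewrite pmulr_rle0 // ltW.
      have [s sD] : exists s, s ^+ 2 = D by exists (Num.sqrt D); rewrite sqr_sqrtr.
      (* Opposite signs make the discriminant of q along the pencil nonnegative, and [r] is a root.
         The value there is nonzero, since collinear values would have q of the same sign. *)
      pose r := (- be - s) / (2%:R * q (f (upd u l y))).
      have q_ne0 : q (f (upd u l y)) != 0 by rewrite lt_eqF.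
      apply: no; exists (upd u l (u l + r *: y)).
      rewrite (multilinD fL) upd_id (multilinZ fL); split; last first.
        rewrite qE; transitivity ((s ^+ 2 - D) / (4%:R * q (f (upd u l y)))).
          by rewrite /r /D; field.
        by rewrite sD subrr mul0r.
      apply/eqP => e.
      have fuE : f u = - r *: f (upd u l y) by rewrite scaleNr; apply/eqP; rewrite -addr_eq0 e.
      move: qu; rewrite fuE yE quatZ /q !tK ltNge => /negP; apply.
      have -> : q0 (- r * y0, - r * y1, - r * y2, - r * y3) =
          r ^+ 2 * q0 (y0, y1, y2, y3) by rewrite /q0 /hnorm /=; ring.
      by rewrite mulr_ge0_le0 ?sqr_ge0 //; move: qy; rewrite yE /q tK => /ltW.
    - by rewrite fv; apply: contraNneq c0 => /hquat_eq0[->].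
    - by rewrite fw; apply/eqP => /hquat_eq0[_ /eqP]; rewrite oner_eq0.
  have : 0 < q (f v).
    rewrite fv /q tK /q0 /hnorm /=.
    have -> : c ^+ 2 - k * (c ^+ 2 - a * 0 ^+ 2 - b * 0 ^+ 2 + a * b * 0 ^+ 2) =
      (1 - k) * c ^+ 2 by ring.
    by rewrite mulr_gt0 ?subr_gt0 // lt_def sqrf_eq0 c0 sqr_ge0.
  move=> /Rvw; rewrite fw /q tK /q0 /hnorm /=.
  have -> : 0 ^+ 2 - k * (0 ^+ 2 - a * 1 ^+ 2 - b * 0 ^+ 2 + a * b * 0 ^+ 2) =
    k * a by ring.
  by rewrite pmulr_rgt0 // ltNge ltW.
have [w0 [w1 [w2 [w3 fw]]]] := span (f w).
rewrite fw /q tK /q0 /= in qw fw0.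
have Nw : 0 < hnorm w0 w1 w2 w3.
  rewrite ltNge; apply: contra fw0 => /hnorm_eq0[-> -> -> ->].
  by rewrite quat0.
have w00 : w0 != 0.
  apply: contraTneq Nw => w00; move/eqP: qw; rewrite w00 expr0n sub0r oppr_eq0.
  by rewrite mulf_eq0 gt_eqF //= => /eqP->; rewrite ltxx.
pose r := x0 / w0.
have rw : r * w0 = x0 by rewrite divfK.
have e : hnorm x0 (r * w1) (r * w2) (r * w3) = hnorm x0 x1 x2 x3.
  transitivity (r ^+ 2 * hnorm w0 w1 w2 w3); first by rewrite -rw /hnorm; ring.
  have -> : hnorm w0 w1 w2 w3 = w0 ^+ 2 / k.
    by rewrite (subr0_eq qw) [k * _]mulrC mulfK // gt_eqF.
  rewrite mulrA -exprMn rw /k invf_div mulrC divfK //.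
  by rewrite sqrf_eq0.
apply: (hquat_conjugate (@mlimage_conj _ _ _ _) e); first by rewrite e.
have [l _] := m0; exists (upd w l (r *: w l)).
by rewrite (multilinZ fL) upd_id fw quatZ rw.
Qed.

End HamiltonQuaternions.

(** * Images *)

Local Open Scope classical_set_scope.

Section Images.
Variables (F : fieldType) (H : falgType F).

Lemma s2_imageP (x : H) :
  poly_image (s2 F) H x <-> exists y z, x = y * z - z * y.
Proof.
have s2E (u : 'I_2 -> H) :
    free_eval u (s2 F) = u ord0 * u ord_max - u ord_max * u ord0.
  rewrite /free_eval /s2 /free_var raddfB /= !malgM_def !fgmulUU !mulr1 !mmapU.
  by rewrite /= scale1r !mul1r !fmM !fmU /= !big_cons !big_nil !mulr1.
split=> [[u _ <-]|[y [z ->]]]; first by exists (u ord0), (u ord_max).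
by exists (fun k : 'I_2 => if k == ord0 then y else z); rewrite ?s2E.
Qed.

Lemma s2_image_conj : conj_closed (poly_image (s2 F) H).
Proof.
move=> z z' x zz' z'z /s2_imageP[y [t ->]]; apply/s2_imageP.
have conjM v w : z * v * z' * (z * w * z') = z * (v * w) * z'.
  by rewrite !mulrA -(mulrA _ z' z) z'z mulr1.
exists (z * y * z'), (z * t * z').
by rewrite !conjM mulrBr mulrBl.
Qed.

(** Off-diagonal matrices are commutators with e11; in characteristic 2 the scalar [a] is the
    commutator of [a] e12 with e21. *)
Lemma s2_image_mx (E : matrix_coords H) x :
  poly_image (s2 F) H x <-> mxtr E x = 0.
Proof.
split=> [/s2_imageP[y [z ->]]|]; first exact: mxtr_commutator.
move: x; apply: (traceless_sub s2_image_conj) => [b c|a aa]; apply/s2_imageP.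
  exists (E 1 0 0 0), (E 0 b (- c) 0).
  by rewrite !mx_mul mxB; congr (mx E); ring.
exists (E 0 a 0 0), (E 0 0 1 0); rewrite !mx_mul mxB.
have aN : a = - a by apply/eqP; rewrite -addr_eq0 aa.
by rewrite {2}aN; congr (mx E); ring.
Qed.

Variables (m : nat) (p : free_algebra F m) (lam : 'S_m -> F).
Hypothesis pE : forall u : 'I_m -> H, free_eval u p = mleval lam u.
Hypothesis m0 : exists l : 'I_m, True.

Lemma poly_imageP (x : H) : poly_image p H x <-> mlimage lam x.
Proof.
split=> [[u _ <-]|[u <-]]; first by exists u; rewrite pE.
by exists u; rewrite ?pE.
Qed.

Lemma scalar_image :
  (forall u : 'I_m -> H, exists k : F, mleval lam u = k%:A) ->
  poly_image p H = [set 0] \/ poly_image p H = scalars H.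
Proof.
move=> sc; have [[u fu0]|no] := pselect (exists u : 'I_m -> H, mleval lam u != 0).
  right; apply/seteqP; split=> [x /poly_imageP[v <-]|_ [k _ <-]].
    by have [k ->] := sc v; exists k.
  have [c fu] := sc u; apply/poly_imageP.
  have c0 : c != 0 by apply: contraNneq fu0 => c0; rewrite fu c0 scale0r.
  rewrite -(divfK c0 k) -scalerA -fu.
  by apply: mlimage_scale => //; exists u.
left; have zero u : mleval lam u = 0 :> H.
  by apply/eqP; apply: contrapT => /negP fu0; apply: no; exists u.
apply/seteqP; split=> [x /poly_imageP[v <-]|_ ->]; first exact: zero.
by apply/poly_imageP; exists (fun=> 0).
Qed.

Lemma matrix_image (E : matrix_coords H) :
  [\/ poly_image p H = [set 0], poly_image p H = scalars H
    | poly_image (s2 F) H `<=` poly_image p H].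
Proof.
have [/scalar_image[]|sub] := scalar_or_traceless_sub E lam m0.
- by move=> ->; apply: Or31.
- by move=> ->; apply: Or32.
by apply: Or33 => x /(s2_image_mx E)/sub/poly_imageP.
Qed.

Lemma matrix_image_full (E : matrix_coords H) :
  (~ (forall u : 'I_m -> H, exists k : F, mleval lam u = k%:A) ->
   ~ (forall u, mxtr E (mleval lam u) = 0) -> forall x : H, mlimage lam x) ->
  [\/ poly_image p H = [set 0], poly_image p H = scalars H,
      poly_image p H = poly_image (s2 F) H | poly_image p H = [set: H]].
Proof.
move=> full; have [/scalar_image[]|nsc] :=
  pselect (forall u : 'I_m -> H, exists k : F, mleval lam u = k%:A).
- by move=> ->; apply: Or41.
- by move=> ->; apply: Or42.
have [tr0|ntr] := pselect (forall u, mxtr E (mleval lam u) = 0).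
  have [//|sub] := scalar_or_traceless_sub E lam m0.
  apply: Or43; apply/seteqP; split=> x.
    by move=> /poly_imageP[u <-]; apply/(s2_image_mx E).
  by move=> /(s2_image_mx E)/sub/poly_imageP.
by apply: Or44; apply/seteqP; split=> // x _; apply/poly_imageP/full.
Qed.

End Images.

Lemma hquat_image (R : rcfType) (H : falgType R) (a b : R) (i j : H)
    (m : nat) (p : free_algebra R m) (lam : 'S_m -> R) :
  quat_gen 0 a b i j -> a < 0 -> b < 0 ->
  (forall u : 'I_m -> H, free_eval u p = mleval lam u) ->
  (exists l : 'I_m, True) ->
  [\/ poly_image p H = [set 0], poly_image p H = scalars H,
      poly_image p H = poly_image (s2 R) H | poly_image p H = [set: H]].
Proof.
move=> gen a0 b0 pE m0.
have s2P x : poly_image (s2 R) H x <-> re_zero i j x.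
  split=> [/s2_imageP[y [z ->]]|[x1 [x2 [x3 ->]]]].
    have [_ _ _ span] := gen.
    have [y0 [y1 [y2 [y3 ->]]]] := span y; have [z0 [z1 [z2 [z3 ->]]]] := span z.
    rewrite !(quat_mul gen) -scaleN1r quatZ quatD.
    by eexists _, _, _; congr quat; ring.
  (* The commutator of [i] and [j] is 2ij, a nonzero pure quaternion, whose conjugates and multiples
     give all the others. *)
  have comm : quat i j 0 0 0 2%:R =
      quat i j 0 1 0 0 * quat i j 0 0 1 0 - quat i j 0 0 1 0 * quat i j 0 1 0 0.
    by rewrite !(quat_mul gen) -scaleN1r quatZ quatD; congr quat; ring.
  apply: (hquat_pure_sub gen a0 b0 (v1 := 0) (v2 := 0) (v3 := 2%:R)).
  - exact: s2_image_conj.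
  - move=> r y /s2_imageP[z [t ->]]; apply/s2_imageP; exists (r *: z), t.
    by rewrite -scalerAl -scalerAr scalerBr.
  - by apply/s2_imageP; exists (quat i j 0 1 0 0), (quat i j 0 0 1 0).
  - by apply/eqP => /(hquat_eq0 gen a0 b0)[_ _ _ /eqP]; rewrite pnatr_eq0.
have [/(scalar_image pE m0)[]|nsc] :=
  pselect (forall u : 'I_m -> H, exists k : R, mleval lam u = k%:A).
- by move=> ->; apply: Or41.
- by move=> ->; apply: Or42.
have [re0|nre] := pselect (forall u, re_zero i j (mleval lam u)).
  have [//|pure] := hquat_scalar_or_pure gen a0 b0 lam m0.
  apply: Or43; apply/seteqP; split=> x.
    by move=> /(poly_imageP pE)[u <-]; apply/s2P.
  by move=> /s2P[x1 [x2 [x3 ->]]]; apply/(poly_imageP pE).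
apply: Or44; apply/seteqP; split=> // x _; apply/(poly_imageP pE).
exact: (hquat_full gen a0 b0).
Qed.

(** * The split case and the real case *)

Lemma multilinear_eval (F : fieldType) (m : nat) (p : free_algebra F m) :
  multilinear p -> exists lam : 'S_m -> F, forall (H : falgType F) u,
    free_eval u p = mleval lam u :> H.
Proof. by move=> [lam pE]; exists lam => H u; apply: free_eval_mleval. Qed.

Theorem proposition2p1 :
  (forall (F : fieldType) (H : falgType F) (m : nat)
      (p : free_algebra F m),
    is_quaternion_algebra H -> (1 < m)%N -> multilinear p ->
    ~ is_division_ring H ->
    [\/ poly_image p H = [set 0],
        poly_image p H = scalars H
      | poly_image (s2 F) H `<=` poly_image p H]
    /\
    (quadratically_closed F ->
     [\/ poly_image p H = [set 0],
         poly_image p H = scalars H,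
         poly_image p H = poly_image (s2 F) H
       | poly_image p H = [set: H]]))
  /\
  (forall (R : realType) (H : falgType R) (m : nat)
      (p : free_algebra R m),
    is_quaternion_algebra H -> (1 < m)%N -> multilinear p ->
    [\/ poly_image p H = [set 0],
        poly_image p H = scalars H,
        poly_image p H = poly_image (s2 R) H
      | poly_image p H = [set: H]]).
Proof.
split.
  move=> F H m p Hquat m1 /multilinear_eval[lam pE] ndiv.
  have m0 : exists l : 'I_m, True by exists (Ordinal (ltnW m1)).
  have [E] := split_quaternion Hquat ndiv; split; first exact: (matrix_image (pE H)).
  move=> sqF; apply: (matrix_image_full (pE H) m0 (E := E)) => nsc ntr.
  have [F2|F2] := eqVneq (2%:R : F) 0.
    exact: (full_image_char2 F2 sqF m0 nsc ntr).
  exact: (full_image_odd F2 (quadratically_closed_perturbation F2 sqF) m0 nsc ntr).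
move=> R H m p Hquat m1 /multilinear_eval[lam pE].
have m0 : exists l : 'I_m, True by exists (Ordinal (ltnW m1)).
have R2 : 2%:R != 0 :> R by rewrite pnatr_eq0.
have [eps [a [b [i [j [gen b0 disc0 /(_ R2) eps0]]]]]] := quaternion_generators Hquat.
rewrite {eps}eps0 in gen disc0.
have a0 : a != 0.
  by apply: contraNneq disc0 => ->; rewrite mulr0 expr0n addr0.
have [/andP[an bn]|pos] := boolP ((a < 0) && (b < 0)).
  exact: (hquat_image gen an bn (pE H)).
have [s gs] : exists s, quat_gen 0 a 1 i s.
  apply: (quat_split gen b0).
  (* If [b > 0], it is the norm of its square root; otherwise [a > 0], and the square root of [a]
     plus [i] is an isotropic vector. *)
  have [bp|bn] := ltP 0 b.
    by exists (Num.sqrt b), 0; rewrite /knorm sqr_sqrtr ?ltW //; ring.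
  have ap : 0 < a.
    move: pos; rewrite lt_neqAle a0 [b < 0]lt_neqAle b0 bn /= andbT -ltNge.
    by [].
  apply: (@knorm_represents _ 0 a b (Num.sqrt a) 1 0 0) => //.
    by rewrite /knorm sqr_sqrtr ?ltW //; ring.
  by rewrite oner_eq0 orbT.
have [E] := quat_matrix gs disc0.
apply: (matrix_image_full (pE H) m0 (E := E)) => nsc ntr.
exact: (full_image_odd R2 (@real_perturbation R) m0 nsc ntr).
Qed.
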